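(* Suppose $A\in M_d(\mathbb C)^g$ and $\mathcal D_A$ is bounded. If $f$ is a (matrix-valued) free function that is analytic and bounded on a free pseudoconvex set $\mathcal G_Q$ containing $\mathcal D_A$, then $f$ is uniformly approximable by polynomials on $\mathcal D_A$; that is, for each $\epsilon>0$ there is a (matrix-valued) free analytic polynomial $q$ such that $\|f(X)-q(X)\|<\epsilon$ for every $n$ and every $X\in\mathcal D_A(n)$.
   Context: For $A\in M_d(\mathbb C)^g$ and $X\in M_n(\mathbb C)^g$ let $L_A(X)=I+\sum_jA_j\otimes X_j+\big(\sum_jA_j\otimes X_j\big)^*$. $\mathcal D_A=(\mathcal D_A(n))_n$, $\mathcal D_A(n)=\{X\in M_n(\mathbb C)^g:L_A(X)\succeq0\}$; it is bounded if there is $N$ with $\|X\|\le N$ for all $n$ and all $X\in\mathcal D_A(n)$. A free analytic polynomial is a polynomial in freely noncommuting variables $x_1,\dots,x_g$ only (no adjoints); a matrix-valued one $Q=\sum_wQ_ww$ is evaluated at $X\in M_n(\mathbb C)^g$ by $Q(X)=\sum_wQ_w\otimes w(X)$. A free pseudoconvex set is a set of the form $\mathcal G_Q=\{X:\|Q(X)\|<1\}$ (over all sizes $n$) for a matrix-valued free analytic polynomial $Q$. A free function on a free set (closed under direct sums and unitary similarity) is a sequence of functions on the matrix levels respecting intertwinings: if $X\Gamma=\Gamma Y$ then $f(X)\Gamma=\Gamma f(Y)$ (with $\Gamma$ replaced by $I\otimes\Gamma$ for matrix-valued $f$). It is analytic if its domain is levelwise open and it is analytic on each level; bounded means $\|f(X)\|$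 is bounded uniformly over all $X$ of all sizes. *)

(* Defs.v *)
From HB Require Import structures.
From mathcomp Require Import all_boot all_order all_algebra finmap.
From mathcomp Require Import complex mxtens.
From mathcomp Require Import all_classical all_reals all_analysis.

Set Implicit Arguments.
Unset Strict Implicit.
Unset Printing Implicit Defensive.

Import Order.TTheory GRing.Theory Num.Theory.
Import numFieldNormedType.Exports.
Local Open Scope classical_set_scope.
Local Open Scope ring_scope.
Local Open Scope sesquilinear_scope.

(* In this file the complex field is R[i], for R : realType; M ^t* is the
   adjoint and A *t B is the Kronecker product.  All size parameters may be 0;
   level 0 consists of empty matrices and imposes no constraint. *)

Section MatrixNorm.
Context {R : realType}.

Definition l2norm m (v : 'cV[R[i]]_m) : R :=
  Num.sqrt (complex.Re ((v ^t* *m v) 0 0)).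

(* The bound 1 on l2norm v, rather than equality with 1, makes the supremum
   range over a nonempty set even for matrices without columns. *)
Definition opnorm m p (M : 'M[R[i]]_(m, p)) : R :=
  sup [set l2norm (M *m v) | v in [set v : 'cV[R[i]]_p | l2norm v <= 1]].

(* In R[i], 0 <= z means that z is real and nonnegative. *)
Definition psdmx m (M : 'M[R[i]]_m) : Prop :=
  M \is hermsymmx /\ forall v : 'cV[R[i]]_m, 0 <= (v ^t* *m M *m v) 0 0.

Definition mxtuple (g n : nat) : Type := 'I_g -> 'M[R[i]]_n.

Definition tuple_norm g n (X : mxtuple g n) : R :=
  \big[Num.max/0]_(j < g) opnorm (X j).

(* A graded set: one set of g-tuples at each matrix size. *)
Definition levelset (g : nat) : Type := forall n : nat, set (mxtuple g n).

Definition free_bounded g (D : levelset g) : Prop :=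
  exists N : R, forall n (X : mxtuple g n), D n X -> tuple_norm X <= N.

Definition levelwise_open g (D : levelset g) : Prop :=
  forall n (X : mxtuple g n), D n X -> exists2 r : R, 0 < r &
    forall H : mxtuple g n, tuple_norm H < r -> D n (fun j => X j + H j).

End MatrixNorm.

Arguments mxtuple R g n : clear implicits.
Arguments levelset R g : clear implicits.

Section Spectrahedron.
Context {R : realType} {g d : nat}.
Implicit Type A : mxtuple R g d.

Definition homogeneous_pencil A n (X : mxtuple R g n) : 'M[R[i]]_(d * n) :=
  \sum_(j < g) (A j *t X j).

Definition monic_pencil A n (X : mxtuple R g n) : 'M[R[i]]_(d * n) :=
  1%:M + homogeneous_pencil A X + (homogeneous_pencil A X) ^t*.

Definition free_spectrahedron A : levelset R g :=
  fun n => [set X | psdmx (monic_pencil A X)].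

End Spectrahedron.

Arguments free_spectrahedron {R g d} A n _.

Section FreePolynomial.
Context {R : realType}.

(* Finitely supported families of k x l coefficients indexed by the words in
   the letters x_0, ..., x_(g-1); nil is the empty word. *)
Definition freepoly (g k l : nat) : Type :=
  {fsfun seq 'I_g -> 'M[R[i]]_(k, l) with 0}.

Definition word_eval g n (X : mxtuple R g n) (w : seq 'I_g) : 'M[R[i]]_n :=
  foldr (fun j (M : 'M[R[i]]_n) => X j *m M) 1%:M w.

Definition freepoly_eval g k l (Q : freepoly g k l) n (X : mxtuple R g n) :
    'M[R[i]]_(k * n, l * n) :=
  \sum_(w <- finsupp Q) (Q w *t word_eval X w).

Definition pseudoconvex_set g k l (Q : freepoly g k l) : levelset R g :=
  fun n => [set X | opnorm (freepoly_eval Q X) < 1].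

End FreePolynomial.

Arguments freepoly R g k l : clear implicits.
Arguments pseudoconvex_set {R g k l} Q n _.

Section FreeFunction.
Context {R : realType} {g k l : nat}.

(* The values of such a family outside its intended domain are irrelevant;
   all the predicates below only constrain it on D. *)
Definition graded_fun : Type :=
  forall n : nat, mxtuple R g n -> 'M[R[i]]_(k * n, l * n).

Definition free_function (D : levelset R g) (f : graded_fun) : Prop :=
  forall n m (X : mxtuple R g n) (Y : mxtuple R g m) (G : 'M[R[i]]_(n, m)),
    D n X -> D m Y -> (forall j, X j *m G = G *m Y j) ->
    f n X *m ((1%:M : 'M[R[i]]_l) *t G) = ((1%:M : 'M[R[i]]_k) *t G) *m f m Y.

Section PowerSeries.
Context {n : nat}.

Definition entry : Type := ('I_g * 'I_n * 'I_n)%type.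

(* c assigns a matrix coefficient to each multi-index in the g n^2 scalar
   variables H j p q. *)
Definition ps_term (c : (entry -> nat) -> 'M[R[i]]_(k * n, l * n))
    (H : mxtuple R g n) (a : entry -> nat) : 'M[R[i]]_(k * n, l * n) :=
  (\prod_(e : entry) H e.1.1 e.1.2 e.2 ^+ a e) *: c a.

(* Over the multi-indices all of whose exponents are < N. *)
Definition ps_partial c (H : mxtuple R g n) (N : nat) :
    'M[R[i]]_(k * n, l * n) :=
  \sum_(a : {ffun entry -> 'I_N}) ps_term c H (fun e => a e : nat).

Definition ps_abs_partial c (H : mxtuple R g n) (N : nat) : R :=
  \sum_(a : {ffun entry -> 'I_N}) opnorm (ps_term c H (fun e => a e : nat)).

Definition analytic_at (F : mxtuple R g n -> 'M[R[i]]_(k * n, l * n))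
    (X : mxtuple R g n) : Prop :=
  exists (c : (entry -> nat) -> 'M[R[i]]_(k * n, l * n)) (r : R),
    0 < r /\ forall H : mxtuple R g n, tuple_norm H < r ->
      cvgn (ps_abs_partial c H) /\
      (fun N => opnorm (F (fun j => X j + H j) - ps_partial c H N))
        @ \oo --> (0 : R).

End PowerSeries.

Definition analytic_on (D : levelset R g) (f : graded_fun) : Prop :=
  levelwise_open D /\ forall n (X : mxtuple R g n), D n X -> analytic_at (f n) X.

Definition bounded_fun_on (D : levelset R g) (f : graded_fun) : Prop :=
  exists C : R, forall n (X : mxtuple R g n), D n X -> opnorm (f n X) <= C.

Definition poly_approximable_on (D : levelset R g) (f : graded_fun) : Prop :=
  forall eps : R, 0 < eps -> exists q : freepoly R g k l,
    forall n (X : mxtuple R g n), D n X ->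
      opnorm (f n X - freepoly_eval q X) < eps.

End FreeFunction.

Arguments graded_fun R g k l : clear implicits.

(* Main.v *)
Require Import Defs.
From mathcomp Require Import all_boot all_order all_algebra.
From mathcomp Require Import all_classical all_reals all_analysis.
From mathcomp Require Import finmap complex mxtens ring lra.

(** Fix X in the spectrahedron D_A and look at F(x) = f(x X) for x in [0, 1],
    which makes sense because D_A is convex and contains 0.  The value wanted is
    F(1); near x = 0 the function F is given by its Taylor series, whose
    coefficients are homogeneous free polynomials in X.  The proof continues
    this approximation along [0, 1] by Newton interpolation, in finitely many
    steps and with errors that do not depend on X nor on its size.

    The uniformity comes from two facts.  The first is that the contractivity of
    Q on D_A is uniform: sup ||Q(X)|| < 1 over all X in D_A of all sizes
    ([spectrahedron_freepoly_uniform_lt1]).  Indeed ||Q(X) v|| only depends on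
    the compression of X to the span of the vectors w(X) v_j with w a suffix of
    a word of Q; the dimension of this span is bounded in terms of Q alone, and
    compressions of X remain in D_A by matrix convexity ([freepoly_compress]),
    so that everything happens at one matrix size, where D_A is compact.
    Since words are Lipschitz on bounded sets independently of the size, it
    follows that the set of Q contains a neighbourhood of D_A of constant
    radius.

    The second is that free functions satisfy Cauchy estimates for free.  Let T
    be the upper bidiagonal matrix with nodes t_0, ..., t_p in [0, 1] on the
    diagonal and a small constant K on the superdiagonal.  The tuple of the
    T (x) X_j is within K ||X|| of a direct sum of points t_i X of D_A, hence
    it lies in the set of Q for a K that is independent of p, X and the nodes
    ([pseudoconvex_newton]), and f is bounded there by a constant B.
    The eigenvectors of T are the values of the Newton polynomials at the
    nodes, and f respects the intertwinings that they define.  Therefore the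
    upper right block of f(T (x) X), which has norm at most B, is K^p times the
    divided difference of F at t_0, ..., t_p.  This is the remainder term of
    Newton interpolation: if x is at distance at most K / 2 from the other
    nodes, interpolating F(x) from p nodes has error at most B / 2^p
    ([newton_interpolation]).  So approximability at all points of [0, a] gives
    approximability on [0, a + K / 4] ([approximable_step]).

    The starting point uses the node 0 with multiplicity p, for which the
    interpolant is assembled from the value of f at jointly nilpotent tuples.
    There f is a polynomial: an intertwiner maps the left creation operators on
    the truncated Fock space to any nilpotent situation, so the coefficients can
    be read off the value of f at the creation operators
    ([free_function_nilpotent_vec], [taylor_approximation]). *)

Set Implicit Arguments.
Unset Strict Implicit.
Unset Printing Implicit Defensive.

Import Order.TTheory GRing.Theory Num.Theory.
Import numFieldNormedType.Exports.
Import Normc.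
Local Open Scope classical_set_scope.
Local Open Scope ring_scope.
Local Open Scope sesquilinear_scope.

(** * Euclidean and operator norms *)

Section Norms.
Context {R : realType}.
Local Notation C := R[i].

Lemma normc_ge0 (z : C) : 0 <= normc z.
Proof. by case: z => a b; exact: sqrtr_ge0. Qed.

Lemma normc_sqr (z : C) : normc z ^+ 2 = complex.Re z ^+ 2 + complex.Im z ^+ 2.
Proof. by case: z => a b /=; rewrite sqr_sqrtr // addr_ge0 ?sqr_ge0. Qed.

Lemma normc_real (t : R) : normc (t%:C)%C = `|t|.
Proof. by rewrite /= expr0n addr0 sqrtr_sqr. Qed.

(** Summed over coordinates, with s the ratio of the two lengths, this gives
    the triangle inequality without passing through Cauchy--Schwarz. *)
Lemma normcD_sqr (s : R) (x y : C) : 0 < s ->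
  normc (x + y) ^+ 2 <= (1 + s) * normc x ^+ 2 + (1 + s^-1) * normc y ^+ 2.
Proof.
move=> s0; rewrite !normc_sqr; case: x y => a b [c d] /=.
rewrite -subr_ge0.
have -> : (1 + s) * (a ^+ 2 + b ^+ 2) + (1 + s^-1) * (c ^+ 2 + d ^+ 2) -
   ((a + c) ^+ 2 + (b + d) ^+ 2)
   = s^-1 * ((s * a - c) ^+ 2 + (s * b - d) ^+ 2).
  by field; rewrite gt_eqF.
by apply: mulr_ge0; [rewrite invr_ge0 ltW|apply: addr_ge0; exact: sqr_ge0].
Qed.

Lemma l2norm_sqr m (v : 'cV[C]_m) :
  l2norm v ^+ 2 = \sum_i normc (v i 0) ^+ 2.
Proof.
rewrite /l2norm.
have -> : complex.Re ((v ^t* *m v) 0 0) = \sum_i normc (v i 0) ^+ 2.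
  rewrite mxE (raddf_sum (@complex.Re R : {additive Rcomplex R -> R})).
  apply: eq_bigr => i _; rewrite !mxE normc_sqr.
  by case: (v i 0) => a b /=; rewrite mulNr opprK -!expr2.
by rewrite sqr_sqrtr // sumr_ge0 // => i _; rewrite sqr_ge0.
Qed.

Lemma l2norm_ge0 m (v : 'cV[C]_m) : 0 <= l2norm v.
Proof. exact: sqrtr_ge0. Qed.

Lemma l2norm0 m : l2norm (0 : 'cV[C]_m) = 0.
Proof. by rewrite /l2norm mulmx0 mxE sqrtr0. Qed.

Lemma l2norm_le_sqr m n (v : 'cV[C]_m) (w : 'cV[C]_n) (K : R) : 0 <= K ->
  l2norm v ^+ 2 <= K ^+ 2 * l2norm w ^+ 2 -> l2norm v <= K * l2norm w.
Proof.
move=> K0; rewrite -exprMn => h.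
by rewrite -(ler_pXn2r (n := 2)) // nnegrE ?mulr_ge0 ?l2norm_ge0.
Qed.

Lemma l2norm_coord m (v : 'cV[C]_m) i : normc (v i 0) <= l2norm v.
Proof.
rewrite -(ler_pXn2r (n := 2)) // ?nnegrE ?normc_ge0 ?l2norm_ge0 //.
rewrite l2norm_sqr (bigD1 i) //= lerDl.
by rewrite sumr_ge0 // => j _; rewrite sqr_ge0.
Qed.

Lemma l2norm_eq0 m (v : 'cV[C]_m) : l2norm v = 0 -> v = 0.
Proof.
move=> v0; apply/matrixP => i j; rewrite ord1 mxE; apply: eq0_normc.
by apply/le_anti; rewrite normc_ge0 -v0 l2norm_coord.
Qed.

Lemma l2normZ m (c : C) (v : 'cV[C]_m) : l2norm (c *: v) = normc c * l2norm v.
Proof.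
apply/eqP; rewrite -(eqrXn2 (n := 2)) // ?mulr_ge0 ?l2norm_ge0 ?normc_ge0 //.
rewrite exprMn !l2norm_sqr mulr_sumr; apply/eqP/eq_bigr => i _.
by rewrite mxE normcM exprMn.
Qed.

Lemma l2normD m (v w : 'cV[C]_m) : l2norm (v + w) <= l2norm v + l2norm w.
Proof.
have [v0|vn0] := eqVneq (l2norm v) 0.
  by rewrite (l2norm_eq0 v0) l2norm0 !add0r.
have [w0|wn0] := eqVneq (l2norm w) 0.
  by rewrite (l2norm_eq0 w0) l2norm0 !addr0.
have vp : 0 < l2norm v by rewrite lt_def vn0 l2norm_ge0.
have wp : 0 < l2norm w by rewrite lt_def wn0 l2norm_ge0.
rewrite -(ler_pXn2r (n := 2)) // ?nnegrE ?addr_ge0 ?l2norm_ge0 //.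
have s0 : 0 < l2norm w / l2norm v by rewrite divr_gt0.
have -> : (l2norm v + l2norm w) ^+ 2 =
   (1 + l2norm w / l2norm v) * l2norm v ^+ 2 +
   (1 + (l2norm w / l2norm v)^-1) * l2norm w ^+ 2.
  by field; rewrite vn0 wn0.
rewrite !l2norm_sqr !mulr_sumr -big_split /=; apply: ler_sum => i _.
by rewrite mxE normcD_sqr.
Qed.

Lemma l2norm_sum m (I : Type) (s : seq I) (F : I -> 'cV[C]_m) :
  l2norm (\sum_(i <- s) F i) <= \sum_(i <- s) l2norm (F i).
Proof.
elim/big_ind2: _ => [|x1 x2 y1 y2 h1 h2|i _]; rewrite ?l2norm0 //.
exact: le_trans (l2normD _ _) (lerD h1 h2).
Qed.

Section Opnorm.
Variables m p : nat.
Implicit Type M : 'M[C]_(m, p).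

Let entry_sum M := \sum_j \sum_i normc (M i j).

(** A crude bound, whose purpose is that the supremum defining [opnorm] is
    taken over a bounded set. *)
Lemma l2norm_mulmx_crude M (v : 'cV[C]_p) :
  l2norm (M *m v) <= entry_sum M * l2norm v.
Proof.
have -> : M *m v = \sum_j \sum_i (M i j * v j 0) *: delta_mx i 0.
  apply/matrixP => a b; rewrite mxE summxE; apply: eq_bigr => j _.
  rewrite summxE (bigD1 a) //= big1 ?addr0.
    by rewrite !mxE ord1 !eqxx mulr1.
  by move=> i ia; rewrite !mxE eq_sym (negbTE ia) mulr0.
apply: le_trans (l2norm_sum _ _) _; rewrite mulr_suml; apply: ler_sum => j _.
apply: le_trans (l2norm_sum _ _) _; rewrite mulr_suml; apply: ler_sum => i _.
rewrite l2normZ normcM -mulrA ler_wpM2l ?normc_ge0 //.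
have -> : l2norm (delta_mx i 0 : 'cV[C]_m) = 1.
  apply/eqP; rewrite -(eqrXn2 (n := 2)) ?l2norm_ge0 // l2norm_sqr.
  rewrite (bigD1 i) //= big1 ?addr0 => [|a ai].
    by rewrite mxE !eqxx normc1 !expr1n.
  by rewrite mxE (negbTE ai) normc0 expr0n.
by rewrite mulr1 l2norm_coord.
Qed.

Let entry_sum_ge0 M : 0 <= entry_sum M.
Proof. by do 2![apply: sumr_ge0 => ? _]; exact: normc_ge0. Qed.

Lemma opnorm_has_sup M :
  has_sup [set l2norm (M *m v) | v in [set v : 'cV[C]_p | l2norm v <= 1]].
Proof.
split; first by exists (l2norm (M *m 0)), 0; rewrite //= l2norm0.
exists (entry_sum M) => _ [v /= v1 <-].
apply: le_trans (l2norm_mulmx_crude _ _) _.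
by rewrite ler_piMr.
Qed.

Lemma opnorm_ge0 M : 0 <= opnorm M.
Proof.
apply: le_trans (l2norm_ge0 (M *m 0)) _.
apply: ub_le_sup; first exact: (opnorm_has_sup M).2.
by exists 0; rewrite //= l2norm0.
Qed.

Lemma l2norm_mulmx M (v : 'cV[C]_p) : l2norm (M *m v) <= opnorm M * l2norm v.
Proof.
have [v0|vn0] := eqVneq (l2norm v) 0.
  by rewrite (l2norm_eq0 v0) mulmx0 !l2norm0 mulr0.
have vp : 0 < l2norm v by rewrite lt_def vn0 l2norm_ge0.
have nv : normc (((l2norm v)^-1)%:C)%C = (l2norm v)^-1.
  by rewrite normc_real ger0_norm // invr_ge0 ltW.
rewrite -ler_pdivrMr // mulrC -{1}nv -l2normZ scalemxAr.
apply: ub_le_sup; first exact: (opnorm_has_sup M).2.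
exists (((l2norm v)^-1)%:C%C *: v) => //=.
by rewrite l2normZ nv mulVf.
Qed.

Lemma opnorm_le M (K : R) : 0 <= K ->
  (forall v : 'cV[C]_p, l2norm (M *m v) <= K * l2norm v) -> opnorm M <= K.
Proof.
move=> K0 h; apply: ge_sup; first exact: (opnorm_has_sup M).1.
by move=> _ [v /= v1 <-]; rewrite (le_trans (h v)) // ler_piMr.
Qed.

Lemma opnorm_le_entries M : opnorm M <= \sum_j \sum_i normc (M i j).
Proof. exact: opnorm_le (entry_sum_ge0 M) (l2norm_mulmx_crude M). Qed.

Lemma normc_entry_le M i j : normc (M i j) <= opnorm M.
Proof.
have d1 : l2norm (delta_mx j 0 : 'cV[C]_p) <= 1.
  rewrite -(ler_pXn2r (n := 2)) ?nnegrE ?l2norm_ge0 // l2norm_sqr.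
  rewrite (bigD1 j) //= big1 ?addr0 => [|a aj].
    by rewrite mxE !eqxx normc1 !expr1n.
  by rewrite mxE (negbTE aj) normc0 expr0n.
have := l2norm_coord (M *m (delta_mx j 0 : 'cV[C]_p)) i.
rewrite -colE mxE => /le_trans; apply; rewrite colE.
apply: le_trans (l2norm_mulmx _ _) _.
by rewrite ler_piMr ?opnorm_ge0.
Qed.

Lemma opnormD M N : opnorm (M + N) <= opnorm M + opnorm N.
Proof.
apply: opnorm_le => [|v]; first by rewrite addr_ge0 ?opnorm_ge0.
rewrite mulmxDl mulrDl; apply: le_trans (l2normD _ _) _.
by rewrite lerD ?l2norm_mulmx.
Qed.

Lemma opnormZ (c : C) M : opnorm (c *: M) <= normc c * opnorm M.
Proof.
apply: opnorm_le => [|v]; first by rewrite mulr_ge0 ?opnorm_ge0 ?normc_ge0.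
by rewrite -scalemxAl l2normZ -mulrA ler_wpM2l ?normc_ge0 ?l2norm_mulmx.
Qed.

Lemma opnorm0 : opnorm (0 : 'M[C]_(m, p)) = 0.
Proof.
apply/le_anti; rewrite opnorm_ge0 andbT; apply: opnorm_le => // v.
by rewrite mul0mx l2norm0 mul0r.
Qed.

Lemma opnormN M : opnorm (- M) = opnorm M.
Proof.
have h (N : 'M[C]_(m, p)) : opnorm (- N) <= opnorm N.
  have -> : - N = (-1 : C) *: N by rewrite scaleN1r.
  by apply: le_trans (opnormZ _ _) _; rewrite normcN normc1 mul1r.
have hN := h (- M); rewrite opprK in hN.
by apply: le_anti; apply/andP; split; [exact: h|exact: hN].
Qed.

Lemma opnormB M N : opnorm (M - N) <= opnorm M + opnorm N.
Proof. by rewrite -(opnormN N) opnormD. Qed.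

Lemma opnorm_sum (I : Type) (s : seq I) (F : I -> 'M[C]_(m, p)) :
  opnorm (\sum_(i <- s) F i) <= \sum_(i <- s) opnorm (F i).
Proof.
elim/big_ind2: _ => [|x1 x2 y1 y2 h1 h2|i _]; rewrite ?opnorm0 //.
exact: le_trans (opnormD _ _) (lerD h1 h2).
Qed.

End Opnorm.

Lemma opnormM m p q (M : 'M[C]_(m, p)) (N : 'M[C]_(p, q)) :
  opnorm (M *m N) <= opnorm M * opnorm N.
Proof.
apply: opnorm_le => [|v]; first by rewrite mulr_ge0 ?opnorm_ge0.
rewrite -mulmxA -mulrA; apply: le_trans (l2norm_mulmx _ _) _.
by rewrite ler_wpM2l ?opnorm_ge0 ?l2norm_mulmx.
Qed.

Lemma opnorm1 m : opnorm (1%:M : 'M[C]_m) <= 1.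
Proof. by apply: opnorm_le => // v; rewrite mul1mx mul1r. Qed.

Lemma l2normE m (v : 'cV[C]_m) : ((l2norm v ^+ 2)%:C)%C = (v ^t* *m v) 0 0.
Proof.
rewrite l2norm_sqr mxE rmorph_sum; apply: eq_bigr => i _.
rewrite !mxE normc_sqr; case: (v i 0) => a b /=; apply/eqP.
by rewrite eq_complex /=; apply/andP; split; apply/eqP; ring.
Qed.

Lemma adjmx_mul m p q (M : 'M[C]_(m, p)) (N : 'M[C]_(p, q)) :
  (M *m N) ^t* = N ^t* *m M ^t*.
Proof. by rewrite trmx_mul map_mxM. Qed.

Lemma adjmxD m p (M N : 'M[C]_(m, p)) : (M + N) ^t* = M ^t* + N ^t*.
Proof. by rewrite !linearD /= map_mxD. Qed.

Lemma adjmx1 m : (1%:M : 'M[C]_m) ^t* = 1%:M.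
Proof. by rewrite trmx1 map_mx1. Qed.

Lemma adjmx_tens m n p q (M : 'M[C]_(m, n)) (N : 'M[C]_(p, q)) :
  (M *t N) ^t* = M ^t* *t N ^t*.
Proof. by rewrite trmx_tens map_mxT. Qed.

Lemma adjmx_sum m p (I : Type) (s : seq I) (F : I -> 'M[C]_(m, p)) :
  (\sum_(i <- s) F i) ^t* = \sum_(i <- s) (F i) ^t*.
Proof. by elim/big_rec2: _ => [|i y x _ <-]; rewrite ?trmx0 ?map_mx0 ?adjmxD. Qed.

(** The column of V and W is an isometry, and V is a corner of it. *)
Lemma opnorm_contraction m p q (V : 'M[C]_(m, p)) (W : 'M[C]_(q, p)) :
  V ^t* *m V + W ^t* *m W = 1%:M -> opnorm V <= 1.
Proof.
move=> VW; apply: opnorm_le => // v; apply: l2norm_le_sqr => //.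
rewrite expr1n mul1r -lecR !l2normE.
have E : v ^t* *m (V ^t* *m V + W ^t* *m W) *m v =
    (V *m v) ^t* *m (V *m v) + (W *m v) ^t* *m (W *m v).
  by rewrite mulmxDr mulmxDl (adjmx_mul V) (adjmx_mul W) !mulmxA.
rewrite VW mulmx1 in E; rewrite {}E.
by rewrite [leRHS]mxE lerDl -l2normE ler0c sqr_ge0.
Qed.

Lemma sum_mxtens (V : nmodType) m n (F : 'I_(m * n) -> V) :
  \sum_i F i = \sum_(a < m) \sum_(b < n) F (mxtens_index (a, b)).
Proof.
rewrite pair_bigA /= (reindex (@mxtens_index m n)) /=.
  by apply: eq_bigr => -[].
by exists (@mxtens_unindex m n) => i _; [exact: mxtens_indexK|exact: mxtens_unindexK].
Qed.

(** A direct sum of copies of B acts on each block of a vector separately. *)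
Lemma opnorm_1tens k m p (B : 'M[C]_(m, p)) :
  opnorm ((1%:M : 'M[C]_k) *t B) <= opnorm B.
Proof.
apply: opnorm_le => [|v]; first exact: opnorm_ge0.
apply: l2norm_le_sqr; first exact: opnorm_ge0.
rewrite !l2norm_sqr !sum_mxtens mulr_sumr; apply: ler_sum => a _.
pose w := \col_b v (mxtens_index (a, b)) 0.
have -> : \sum_(b < p) normc (v (mxtens_index (a, b)) 0) ^+ 2 = l2norm w ^+ 2.
  by rewrite l2norm_sqr; apply: eq_bigr => b _; rewrite mxE.
have -> : \sum_(b < m)
    normc ((((1%:M : 'M[C]_k) *t B) *m v) (mxtens_index (a, b)) 0) ^+ 2
    = l2norm (B *m w) ^+ 2.
  rewrite l2norm_sqr; apply: eq_bigr => b _; congr (normc _ ^+ 2).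
  rewrite !mxE sum_mxtens (bigD1 a) //= [X in _ + X]big1 ?addr0 => [|c ca].
    by apply: eq_bigr => i _; rewrite !tensmxE !mxE eqxx mul1r.
  by rewrite big1 // => i _; rewrite tensmxE !mxE eq_sym (negbTE ca) !mul0r.
by rewrite -exprMn ler_pXn2r ?nnegrE ?mulr_ge0 ?opnorm_ge0 ?l2norm_ge0 ?l2norm_mulmx.
Qed.

Lemma opnorm_tens1 k m p (B : 'M[C]_(m, p)) :
  opnorm (B *t (1%:M : 'M[C]_k)) <= opnorm B.
Proof.
apply: opnorm_le => [|v]; first exact: opnorm_ge0.
apply: l2norm_le_sqr; first exact: opnorm_ge0.
rewrite !l2norm_sqr !sum_mxtens exchange_big [in leRHS]exchange_big.
rewrite mulr_sumr; apply: ler_sum => a _.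
pose w := \col_b v (mxtens_index (b, a)) 0.
have -> : \sum_(b < p) normc (v (mxtens_index (b, a)) 0) ^+ 2 = l2norm w ^+ 2.
  by rewrite l2norm_sqr; apply: eq_bigr => b _; rewrite mxE.
have -> : \sum_(b < m)
    normc (((B *t (1%:M : 'M[C]_k)) *m v) (mxtens_index (b, a)) 0) ^+ 2
    = l2norm (B *m w) ^+ 2.
  rewrite l2norm_sqr; apply: eq_bigr => b _; congr (normc _ ^+ 2).
  rewrite !mxE sum_mxtens; apply: eq_bigr => i _.
  rewrite (bigD1 a) //= [X in _ + X]big1 ?addr0 => [|c ca].
    by rewrite !tensmxE !mxE eqxx mulr1.
  by rewrite !tensmxE !mxE eq_sym (negbTE ca) mulr0 mul0r.
by rewrite -exprMn ler_pXn2r ?nnegrE ?mulr_ge0 ?opnorm_ge0 ?l2norm_ge0 ?l2norm_mulmx.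
Qed.

Lemma opnorm_tens k l m p (A : 'M[C]_(k, l)) (B : 'M[C]_(m, p)) :
  opnorm (A *t B) <= opnorm A * opnorm B.
Proof.
have -> : A *t B = (A *t 1%:M) *m (1%:M *t B).
  by rewrite tensmx_mul mulmx1 mul1mx.
apply: le_trans (opnormM _ _) _.
by rewrite ler_pM ?opnorm_ge0 ?opnorm_tens1 ?opnorm_1tens.
Qed.

End Norms.

(** * Kronecker products, positivity and matrix convexity *)

Section Tens.
Context {R : realType}.
Local Notation C := R[i].

Lemma tensmxDl m n p q (A B : 'M[C]_(m, n)) (M : 'M[C]_(p, q)) :
  (A + B) *t M = A *t M + B *t M.
Proof.
apply/matrixP => i j; case: (mxtens_indexP i) => a b.
by case: (mxtens_indexP j) => c d; rewrite [RHS]mxE !tensmxE mxE mulrDl.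
Qed.

Lemma tensmxDr m n p q (A : 'M[C]_(m, n)) (M N : 'M[C]_(p, q)) :
  A *t (M + N) = A *t M + A *t N.
Proof.
apply/matrixP => i j; case: (mxtens_indexP i) => a b.
by case: (mxtens_indexP j) => c d; rewrite [RHS]mxE !tensmxE mxE mulrDr.
Qed.

Lemma tensmxZl m n p q (z : C) (A : 'M[C]_(m, n)) (M : 'M[C]_(p, q)) :
  (z *: A) *t M = z *: (A *t M).
Proof.
apply/matrixP => i j; case: (mxtens_indexP i) => a b.
by case: (mxtens_indexP j) => c d; rewrite [RHS]mxE !tensmxE mxE mulrA.
Qed.

Lemma tensmxZr m n p q (z : C) (A : 'M[C]_(m, n)) (M : 'M[C]_(p, q)) :
  A *t (z *: M) = z *: (A *t M).
Proof.
apply/matrixP => i j; case: (mxtens_indexP i) => a b.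
by case: (mxtens_indexP j) => c d; rewrite [RHS]mxE !tensmxE mxE mulrCA.
Qed.

Lemma tensmxBr m n p q (A : 'M[C]_(m, n)) (M N : 'M[C]_(p, q)) :
  A *t (M - N) = A *t M - A *t N.
Proof. by rewrite tensmxDr -scaleN1r tensmxZr scaleN1r. Qed.

Lemma tensmx_suml m n p q (I : Type) (s : seq I) (P : pred I)
    (F : I -> 'M[C]_(m, n)) (M : 'M[C]_(p, q)) :
  (\sum_(i <- s | P i) F i) *t M = \sum_(i <- s | P i) F i *t M.
Proof. by elim/big_rec2: _ => [|i y x _ <-]; rewrite ?tens0mx ?tensmxDl. Qed.

Lemma tensmx_sumr m n p q (I : Type) (s : seq I) (P : pred I)
    (A : 'M[C]_(m, n)) (F : I -> 'M[C]_(p, q)) :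
  A *t (\sum_(i <- s | P i) F i) = \sum_(i <- s | P i) A *t F i.
Proof. by elim/big_rec2: _ => [|i y x _ <-]; rewrite ?tensmx0 ?tensmxDr. Qed.

Lemma tens1mx1 m n : (1%:M : 'M[C]_m) *t (1%:M : 'M[C]_n) = 1%:M.
Proof.
apply/matrixP => i j; case: (mxtens_indexP i) => a b.
case: (mxtens_indexP j) => c d; rewrite tensmxE !mxE -natrM mulnb; congr (_%:R).
by rewrite (inj_eq (can_inj (@mxtens_indexK m n))).
Qed.

Lemma mul1tens m n p q (M : 'M[C]_(n, p)) (N : 'M[C]_(p, q)) :
  ((1%:M : 'M[C]_m) *t M) *m ((1%:M : 'M[C]_m) *t N) = (1%:M : 'M[C]_m) *t (M *m N).
Proof. by rewrite tensmx_mul mulmx1. Qed.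

(** The matrix of z |-> v (x) z.  Up to the identification of 1 * n with n this
    is the Kronecker product of v with the identity; the entrywise form spares
    the casts. *)
Definition vtens p (v : 'cV[C]_p) n : 'M[C]_(p * n, n) :=
  \matrix_(i, b) (v (mxtens_unindex i).1 0 * ((mxtens_unindex i).2 == b)%:R).

Lemma vtensE p (v : 'cV[C]_p) n a b c :
  vtens v n (mxtens_index (a, b)) c = v a 0 * (b == c)%:R.
Proof. by rewrite mxE mxtens_indexK. Qed.

Lemma vtensZ p (v : 'cV[C]_p) n (z : C) : vtens (z *: v) n = z *: vtens v n.
Proof. by apply/matrixP => i b; rewrite !mxE mulrA. Qed.

Lemma vtens_sum p n (I : Type) (s : seq I) (P : pred I) (F : I -> 'cV[C]_p) :
  vtens (\sum_(i <- s | P i) F i) n = \sum_(i <- s | P i) vtens (F i) n.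
Proof.
apply/matrixP => i b; rewrite mxE !summxE mulr_suml.
by apply: eq_bigr => c _; rewrite mxE.
Qed.

Lemma vtensD p n (u v : 'cV[C]_p) : vtens (u + v) n = vtens u n + vtens v n.
Proof. by apply/matrixP => i b; rewrite !mxE mulrDl. Qed.

Lemma tens_mul_vtens p q n m (T : 'M[C]_(p, q)) (M : 'M[C]_(m, n)) v :
  (T *t M) *m vtens v n = vtens (T *m v) m *m M.
Proof.
apply/matrixP => i c; case: (mxtens_indexP i) => a b.
rewrite [LHS]mxE [RHS]mxE sum_mxtens [RHS](bigD1 b) //= [X in _ = _ + X]big1 ?addr0.
  rewrite vtensE eqxx mulr1 mxE mulr_suml; apply: eq_bigr => d _.
  rewrite (bigD1 c) //= big1 ?addr0 => [|e ec].
    by rewrite tensmxE vtensE eqxx mulr1 mulrAC.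
  by rewrite vtensE (negbTE ec) !mulr0.
by move=> d db; rewrite vtensE eq_sym (negbTE db) mulr0 mul0r.
Qed.

Lemma adj_vtens_mul p n (u v : 'cV[C]_p) :
  (vtens u n) ^t* *m vtens v n = (((u ^t* *m v) 0 0)%:M : 'M[C]_n).
Proof.
apply/matrixP => b c; rewrite !mxE sum_mxtens -sumrMnl; apply: eq_bigr => a _.
rewrite (bigD1 b) //= big1 ?addr0 => [|d db].
  by rewrite !mxE !mxtens_indexK /= eqxx mulr1 mulrA mulr_natr.
by rewrite !mxE !mxtens_indexK /= (negbTE db) mulr0 rmorph0 mul0r.
Qed.

Lemma vtens_mul_adj p n m (u v : 'cV[C]_p) (M : 'M[C]_(n, m)) :
  vtens u n *m M *m (vtens v m) ^t* = (u *m v ^t*) *t M.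
Proof.
apply/matrixP => i j; case: (mxtens_indexP i) => a b.
case: (mxtens_indexP j) => c d; rewrite tensmxE !mxE big_ord1.
rewrite (bigD1 d) //= [X in _ + X]big1 ?addr0 => [|e ed].
  rewrite !mxE !mxtens_indexK /= eqxx mulr1 (bigD1 b) //= big1 ?addr0 => [|e eb].
    by rewrite vtensE eqxx mulr1 mulrAC.
  by rewrite vtensE eq_sym (negbTE eb) mulr0 mul0r.
by rewrite !mxE !mxtens_indexK /= eq_sym (negbTE ed) mulr0 rmorph0 mulr0.
Qed.

End Tens.

Section Psd.
Context {R : realType}.
Local Notation C := R[i].

Lemma hermsymP m (M : 'M[C]_m) : (M \is hermsymmx) <-> M ^t* = M.
Proof.
split=> [/is_hermitianmxP h|h]; last apply/is_hermitianmxP.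
  by rewrite [RHS]h expr0 scale1r.
by rewrite expr0 scale1r h.
Qed.

Lemma psdmx_conj m p (M : 'M[C]_m) (V : 'M[C]_(m, p)) :
  psdmx M -> psdmx (V ^t* *m M *m V).
Proof.
move=> [/hermsymP hM psdM]; split.
  by apply/hermsymP; rewrite !adjmx_mul trmxCK hM mulmxA.
by move=> v; have := psdM (V *m v); rewrite adjmx_mul !mulmxA.
Qed.

Lemma psdmxD m (M N : 'M[C]_m) : psdmx M -> psdmx N -> psdmx (M + N).
Proof.
move=> [/hermsymP hM psdM] [/hermsymP hN psdN]; split.
  by apply/hermsymP; rewrite adjmxD hM hN.
by move=> v; rewrite mulmxDr mulmxDl mxE addr_ge0.
Qed.

Lemma psdmx0 m : psdmx (0 : 'M[C]_m).
Proof.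
split; first by apply/hermsymP; rewrite trmx0 map_mx0.
by move=> v; rewrite mulmx0 mul0mx mxE.
Qed.

Lemma psdmx1 m : psdmx (1%:M : 'M[C]_m).
Proof.
split; first by apply/hermsymP; rewrite adjmx1.
by move=> v; rewrite mulmx1 -l2normE ler0c sqr_ge0.
Qed.

Lemma psdmx_sum m (I : Type) (s : seq I) (F : I -> 'M[C]_m) :
  (forall i, psdmx (F i)) -> psdmx (\sum_(i <- s) F i).
Proof.
by move=> h; elim/big_rec: _ => [|i x _]; [exact: psdmx0|exact: psdmxD].
Qed.

End Psd.

Section Spectrahedra.
Context {R : realType} {g d : nat}.
Local Notation C := R[i].
Variable A : mxtuple R g d.

Lemma pencil_conj m n (V : 'M[C]_(n, m)) (X : mxtuple R g n) :
  homogeneous_pencil A (fun j => V ^t* *m X j *m V) =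
  (1%:M *t V) ^t* *m homogeneous_pencil A X *m (1%:M *t V).
Proof.
rewrite /homogeneous_pencil mulmx_sumr mulmx_suml; apply: eq_bigr => j _.
by rewrite adjmx_tens adjmx1 !tensmx_mul mulmx1 mul1mx.
Qed.

Lemma pencil_sum n (I : Type) (s : seq I) (X : I -> mxtuple R g n) :
  homogeneous_pencil A (fun j => \sum_(i <- s) X i j) =
  \sum_(i <- s) homogeneous_pencil A (X i).
Proof.
rewrite /homogeneous_pencil exchange_big; apply: eq_bigr => j _.
by rewrite tensmx_sumr.
Qed.

(** Matrix convexity: conjugating by 1 (x) V_i and summing turns the pencils at
    the X_i into the pencil at the combination, up to the constant term.  The
    contribution of W makes up for the latter; it amounts to padding the
    combination with the point 0. *)
Lemma spectrahedron_mconv m n q (I : Type) (s : seq I) (X : I -> mxtuple R g n)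
    (V : I -> 'M[C]_(n, m)) (W : 'M[C]_(q, m)) :
  \sum_(i <- s) (V i) ^t* *m V i + W ^t* *m W = 1%:M ->
  (forall i, free_spectrahedron A n (X i)) ->
  free_spectrahedron A m (fun j => \sum_(i <- s) (V i) ^t* *m X i j *m V i).
Proof.
move=> VW hX.
pose E (i : I) : 'M[C]_(d * n, d * m) := 1%:M *t V i.
pose G : 'M[C]_(d * q, d * m) := 1%:M *t W.
have EG : \sum_(i <- s) (E i) ^t* *m E i + G ^t* *m G = 1%:M.
  have Esum : \sum_(i <- s) (E i) ^t* *m E i =
      (1%:M : 'M[C]_d) *t (\sum_(i <- s) (V i) ^t* *m V i).
    rewrite tensmx_sumr; apply: eq_bigr => i _.
    by rewrite /E adjmx_tens adjmx1 tensmx_mul mulmx1.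
  by rewrite Esum /G adjmx_tens adjmx1 tensmx_mul mulmx1 -tensmxDr VW tens1mx1.
rewrite /free_spectrahedron /=.
have -> : monic_pencil A (fun j => \sum_(i <- s) (V i) ^t* *m X i j *m V i) =
    \sum_(i <- s) (E i) ^t* *m monic_pencil A (X i) *m E i + G ^t* *m 1%:M *m G.
  rewrite /monic_pencil (pencil_sum s (fun i j => (V i) ^t* *m X i j *m V i)).
  rewrite adjmx_sum mulmx1 -EG.
  rewrite [LHS](_ : _ = \sum_(i <- s) ((E i) ^t* *m E i +
    homogeneous_pencil A (fun j => (V i) ^t* *m X i j *m V i) +
    (homogeneous_pencil A (fun j => (V i) ^t* *m X i j *m V i)) ^t*) + G ^t* *m G).
    congr (_ + _); apply: eq_bigr => i _; rewrite !pencil_conj.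
    by rewrite !mulmxDr !mulmxDl mulmx1 !adjmx_mul trmxCK !mulmxA.
  rewrite !big_split /= -!addrA; congr (_ + _).
  by rewrite addrC addrA.
apply: psdmxD; last by apply: psdmx_conj; exact: psdmx1.
by apply: psdmx_sum => i; apply: psdmx_conj; exact: hX.
Qed.

Lemma spectrahedron_conj m n q (X : mxtuple R g n)
    (V : 'M[C]_(n, m)) (W : 'M[C]_(q, m)) :
  V ^t* *m V + W ^t* *m W = 1%:M -> free_spectrahedron A n X ->
  free_spectrahedron A m (fun j => V ^t* *m X j *m V).
Proof.
move=> VW hX.
have -> : (fun j => V ^t* *m X j *m V) =
    (fun j => \sum_(i <- [:: tt]) V ^t* *m X j *m V).
  by apply: funext => j; rewrite big_seq1.
apply: (@spectrahedron_mconv m n q unit [:: tt] (fun=> X) (fun=> V) W) => //.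
by rewrite big_seq1.
Qed.

Lemma spectrahedron0 n : free_spectrahedron A n (fun=> 0).
Proof.
rewrite /free_spectrahedron /= /monic_pencil /homogeneous_pencil.
rewrite big1 => [|j _]; last by rewrite tensmx0.
by rewrite trmx0 map_mx0 !addr0; exact: psdmx1.
Qed.

(** The point is the direct sum of the t_i X, written as a matrix convex
    combination of copies of X with weights t_i on the coordinate blocks. *)
Lemma spectrahedron_diag p n (t : 'I_p -> R) (X : mxtuple R g n) :
  (forall i, 0 <= t i <= 1) -> free_spectrahedron A n X ->
  free_spectrahedron A (p * n)
    (fun j => diag_mx (\row_i ((t i)%:C)%C) *t X j).
Proof.
move=> ht hX.
pose e i : 'cV[C]_p := delta_mx i 0.
pose V i : 'M[C]_(n, p * n) := ((Num.sqrt (t i))%:C)%C *: (vtens (e i) n) ^t*.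
pose W : 'M[C]_(p * n) :=
  diag_mx (\row_i ((Num.sqrt (1 - t i))%:C)%C) *t (1%:M : 'M[C]_n).
have adjZ (a : R) k m (M : 'M[C]_(k, m)) : ((a%:C)%C *: M) ^t* = (a%:C)%C *: M ^t*.
  apply/matrixP => i j; rewrite !mxE rmorphM; congr (_ * _).
  exact: conjc_real.
have VXV i M : (V i) ^t* *m M *m V i = ((t i)%:C)%C *: (delta_mx i i *t M).
  have [t0 _] := andP (ht i).
  rewrite /V adjZ trmxCK -!scalemxAl -scalemxAr scalerA vtens_mul_adj.
  rewrite -rmorphM -expr2 sqr_sqrtr // trmx_delta.
  by rewrite map_delta_mx mul_delta_mx.
have diagE (c : 'I_p -> C) : diag_mx (\row_i c i) = \sum_i c i *: delta_mx i i.
  by rewrite diag_mx_sum_delta; apply: eq_bigr => i _; rewrite mxE.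
have -> : (fun j => diag_mx (\row_i ((t i)%:C)%C) *t X j) =
    (fun j => \sum_i (V i) ^t* *m X j *m V i).
  apply: funext => j; rewrite diagE tensmx_suml.
  by apply: eq_bigr => i _; rewrite VXV tensmxZl.
apply: (@spectrahedron_mconv _ _ _ _ _ (fun=> X) V W) => //.
have -> : W ^t* *m W = diag_mx (\row_i ((1 - t i)%:C)%C) *t (1%:M : 'M[C]_n).
  rewrite /W adjmx_tens adjmx1 tensmx_mul mulmx1; congr (_ *t _).
  rewrite tr_diag_mx map_diag_mx mulmx_diag; congr diag_mx.
  apply/rowP => i; rewrite !mxE.
  rewrite [X in X * _](_ : _ = ((Num.sqrt (1 - t i))%:C)%C); last exact: conjc_real.
  by rewrite -rmorphM -expr2 sqr_sqrtr // subr_ge0; case/andP: (ht i).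
under eq_bigr => i _ do rewrite -(mulmx1 ((V i) ^t*)) VXV -tensmxZl.
rewrite diagE -tensmx_suml -tensmxDl -big_split /=.
rewrite (eq_bigr (fun i => delta_mx i i)) => [|i _].
  by rewrite -mx1_sum_delta tens1mx1.
by rewrite -scalerDl -rmorphD subrKC scale1r.
Qed.

End Spectrahedra.

(** * Words, polynomials and compressions *)

Section Words.
Context {R : realType} {g : nat}.
Local Notation C := R[i].

Lemma opnorm_word_le n (X : mxtuple R g n) (r : R) w :
  (forall j, opnorm (X j) <= r) -> opnorm (word_eval X w) <= r ^+ size w.
Proof.
move=> h; elim: w => [|j w IH] /=; first by rewrite expr0 opnorm1.
rewrite exprS; apply: le_trans (opnormM _ _) _.
by apply: ler_pM; [exact: opnorm_ge0|exact: opnorm_ge0|exact: h|exact: IH].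
Qed.

(** The constant depends on neither the matrix size nor the tuples, which is
    what makes all later estimates uniform over the levels. *)
Lemma word_lipschitz (r : R) w : 0 <= r -> exists2 K : R, 0 <= K &
  forall n (X Y : mxtuple R g n) (e : R), 0 <= e ->
    (forall j, opnorm (X j) <= r) -> (forall j, opnorm (Y j) <= r) ->
    (forall j, opnorm (X j - Y j) <= e) ->
    opnorm (word_eval X w - word_eval Y w) <= K * e.
Proof.
move=> r0; elim: w => [|j w [K K0 IH]].
  by exists 0 => // n X Y e e0 _ _ _ /=; rewrite subrr opnorm0 mul0r.
exists (r * K + r ^+ size w); first by rewrite addr_ge0 ?mulr_ge0 ?exprn_ge0.
move=> n X Y e e0 hX hY hXY /=.
have -> : X j *m word_eval X w - Y j *m word_eval Y w =
    X j *m (word_eval X w - word_eval Y w) + (X j - Y j) *m word_eval Y w.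
  by rewrite mulmxBr mulmxBl addrA subrK.
apply: le_trans (opnormD _ _) _; rewrite mulrDl; apply: lerD.
  rewrite -mulrA; apply: le_trans (opnormM _ _) _.
  by apply: ler_pM; [exact: opnorm_ge0|exact: opnorm_ge0|exact: hX|exact: IH].
apply: le_trans (opnormM _ _) _; rewrite [leRHS]mulrC.
apply: ler_pM; [exact: opnorm_ge0|exact: opnorm_ge0|exact: hXY|].
exact: opnorm_word_le.
Qed.

Lemma freepoly_lipschitz k l (Q : freepoly R g k l) (r : R) : 0 <= r ->
  exists2 K : R, 0 <= K &
  forall n (X Y : mxtuple R g n) (e : R), 0 <= e ->
    (forall j, opnorm (X j) <= r) -> (forall j, opnorm (Y j) <= r) ->
    (forall j, opnorm (X j - Y j) <= e) ->
    opnorm (freepoly_eval Q X - freepoly_eval Q Y) <= K * e.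
Proof.
move=> r0; rewrite /freepoly_eval.
elim: (finsupp Q : seq _) => [|w s [K K0 IH]].
  by exists 0 => // n X Y e e0 _ _ _; rewrite !big_nil subrr opnorm0 mul0r.
have [Kw Kw0 hw] := word_lipschitz w r0.
exists (opnorm (Q w) * Kw + K); first by rewrite addr_ge0 ?mulr_ge0 ?opnorm_ge0.
move=> n X Y e e0 hX hY hXY; rewrite !big_cons opprD addrACA -tensmxBr.
apply: le_trans (opnormD _ _) _; rewrite mulrDl; apply: lerD; last exact: IH.
rewrite -mulrA; apply: le_trans (opnorm_tens _ _) _.
by apply: ler_wpM2l; [exact: opnorm_ge0|exact: hw].
Qed.

(** Words may be repeated, so that linear combinations of polynomials are
    obtained by concatenating and rescaling lists. *)
Definition terms_eval k l (s : seq (seq 'I_g * 'M[C]_(k, l))) n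
    (X : mxtuple R g n) : 'M[C]_(k * n, l * n) :=
  \sum_(t <- s) t.2 *t word_eval X t.1.

Lemma freepoly_of_terms k l (s : seq (seq 'I_g * 'M[C]_(k, l))) :
  exists q : freepoly R g k l, forall n (X : mxtuple R g n),
    freepoly_eval q X = terms_eval s X.
Proof.
pose c w := \sum_(t <- s | t.1 == w) t.2.
have [W hW] : exists W : {fset seq 'I_g}, forall t, t \in s -> t.1 \in W.
  by exists (seq_fset tt (map fst s)) => t ts; rewrite seq_fsetE map_f.
exists [fsfun w in W => c w] => n X; rewrite /freepoly_eval.
rewrite (big_fset_incl _ (B := W)) //=; last 2 first.
- apply/fsubsetP => w; rewrite mem_finsupp fsfunE.
  by case: ifP => //; rewrite eqxx.
- move=> w wW; rewrite memNfinsupp => /eqP ->; exact: tens0mx.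
rewrite [LHS](_ : _ = \sum_(w <- W) \sum_(t <- s | t.1 == w) t.2 *t word_eval X t.1); last first.
  apply: eq_big_seq => w wW; rewrite fsfunE wW tensmx_suml.
  by apply: eq_bigr => t /eqP ->.
rewrite /terms_eval (exchange_big_dep xpredT) //= big_seq [RHS]big_seq.
apply: eq_bigr => t ts; rewrite big_mkcond (big_fsetD1 t.1) /= ?hW // eqxx.
rewrite big_seq_cond big1 ?addr0 // => w.
by rewrite !inE andbT eq_sym => /andP[/negbTE ->].
Qed.

End Words.

Section Compression.
Context {R : realType}.
Local Notation C := R[i].

(** For a partial isometry V the matrix V* V is a projection, hence so is its
    complement, and the two add up to an isometry. *)
Lemma pisom_complement m n (V : 'M[C]_(n, m)) : V *m V ^t* *m V = V ->
  V ^t* *m V + (1%:M - V ^t* *m V) ^t* *m (1%:M - V ^t* *m V) = 1%:M.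
Proof.
move=> hV.
have -> : (1%:M - V ^t* *m V) ^t* = 1%:M - V ^t* *m V.
  by rewrite linearB map_mxB /= adjmx1 adjmx_mul trmxCK.
rewrite mulmxBr mulmx1 mulmxBl mul1mx.
have -> : V ^t* *m V *m (V ^t* *m V) = V ^t* *m V by rewrite -mulmxA (mulmxA V) hV.
by rewrite subrr subr0 addrC subrK.
Qed.

(** Gram--Schmidt.  A partial isometry rather than an isometry is needed because
    N, which has to be the same for all Z, may exceed the rank of Z and n. *)
Lemma pisom_range n N (Z : 'M[C]_(n, N)) :
  exists2 V : 'M[C]_(n, N), V *m V ^t* *m V = V & V *m V ^t* *m Z = Z.
Proof.
elim: N Z => [|N IH] Z; first by exists 0; apply/matrixP => i [].
change 'M[C]_(n, (1 + N)%N) in Z.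
change (exists2 V : 'M[C]_(n, (1 + N)%N), V *m V ^t* *m V = V &
  V *m V ^t* *m Z = Z).
have [V1 hV1 hZ1] := IH (rsubmx Z).
pose z : 'cV[C]_n := lsubmx Z.
pose z' := z - V1 *m V1 ^t* *m z.
have V1z' : V1 ^t* *m z' = 0.
  have hV1' : V1 ^t* *m V1 *m V1 ^t* = V1 ^t*.
    by rewrite -{2}[V1]trmxCK -!adjmx_mul mulmxA hV1.
  by rewrite mulmxBr !mulmxA hV1' subrr.
pose a := ((l2norm z')^-1%:C)%C; pose u := a *: z'.
have adju : u ^t* = a *: z' ^t*.
  by apply/matrixP => i j; rewrite !mxE rmorphM; congr (_ * _); exact: conjc_real.
have uz' : u *m u ^t* *m z' = z'.
  rewrite -mulmxA adju -scalemxAl -!scalemxAr -scalemxAl.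
  have -> : z' ^t* *m z' = ((l2norm z' ^+ 2)%:C)%C%:M.
    by rewrite [LHS]mx11_scalar l2normE.
  rewrite mul_mx_scalar !scalerA -!rmorphM /=.
  have [z0|zn0] := eqVneq (l2norm z') 0; first by rewrite (l2norm_eq0 z0) !scaler0.
  by rewrite -expr2 -exprMn mulVf // expr1n scale1r.
have uu : u *m u ^t* *m u = u by rewrite -scalemxAr uz'.
have V1u : V1 ^t* *m u = 0 by rewrite -scalemxAr V1z' scaler0.
have uV1 : u ^t* *m V1 = 0.
  by rewrite -[V1]trmxCK -adjmx_mul V1u trmx0 map_mx0.
exists (row_mx u V1).
  rewrite tr_row_mx map_col_mx mul_row_col mul_mx_row !mulmxDl uu hV1.
  by rewrite -!mulmxA V1u uV1 !mulmx0 addr0 add0r.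
rewrite tr_row_mx map_col_mx mul_row_col -[Z in LHS]hsubmxK.
rewrite -[RHS]hsubmxK mul_mx_row; congr row_mx; last first.
  have u0 : u *m u ^t* *m rsubmx Z = 0.
    by rewrite -hZ1 -!mulmxA (mulmxA (u ^t*)) uV1 mul0mx mulmx0.
  by rewrite mulmxDl hZ1 u0 add0r.
have zE : lsubmx Z = z' + V1 *m V1 ^t* *m z by rewrite subrK.
have uz : u *m u ^t* *m lsubmx Z = z'.
  rewrite zE mulmxDr uz' -!mulmxA (mulmxA (u ^t*)) uV1.
  by rewrite mul0mx mulmx0 addr0.
by rewrite mulmxDl uz -zE.
Qed.

(** This identification turns v |-> (B (x) M) v into V |-> M V B^T. *)
Definition unvec l n (v : 'cV[C]_(l * n)) : 'M[C]_(n, l) :=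
  \matrix_(a, b) v (mxtens_index (b, a)) 0.

Lemma tens_mul_unvec k l m n (B : 'M[C]_(k, l)) (M M' : 'M[C]_(m, n)) v :
  M *m unvec v = M' *m unvec v -> (B *t M) *m v = (B *t M') *m v.
Proof.
have E (N : 'M[C]_(m, n)) a b : ((B *t N) *m v) (mxtens_index (a, b)) 0 =
    \sum_c B a c * (N *m unvec v) b c.
  rewrite mxE sum_mxtens; apply: eq_bigr => c _; rewrite mxE mulr_sumr.
  by apply: eq_bigr => e _; rewrite tensmxE mxE mulrA.
move=> h; apply/matrixP => i j; rewrite ord1; case: (mxtens_indexP i) => a b.
by rewrite !E h.
Qed.

Variable g : nat.

(** Words are evaluated from the right, so w(X) v is computed through the
    vectors w'(X) v with w' a suffix of w. *)
Definition suffixes (s : seq (seq 'I_g)) : seq (seq 'I_g) :=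
  [seq drop i w | w <- s, i <- iota 0 (size w).+1].

Lemma mem_suffixes s w : w \in s -> w \in suffixes s.
Proof.
by move=> ws; apply/allpairsPdep; exists w, 0%N; rewrite mem_iota drop0.
Qed.

Lemma suffixes_behead s j w : j :: w \in suffixes s -> w \in suffixes s.
Proof.
case/allpairsPdep => w' [i [w's]]; rewrite mem_iota add0n ltnS => /= ile jw.
apply/allpairsPdep; exists w', i.+1; rewrite mem_iota add0n ltnS /=.
have lti : (i < size w')%N by rewrite -subn_gt0 -size_drop -jw.
split=> //; move: jw; rewrite (drop_nth j lti) => -[_ ->] //.
Qed.

(** A vector Q(X) v only involves the span of the vectors w(X) v_j, for w a
    suffix of a word of Q, where v = (v_j); the dimension of this span is bounded
    in terms of Q alone, and compressing X to it stays inside the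
    spectrahedron. *)
Lemma freepoly_compress d k l (Q : freepoly R g k l) : exists N : nat,
  forall (A : mxtuple R g d) n (X : mxtuple R g n) (v : 'cV[C]_(l * n)),
  free_spectrahedron A n X ->
  exists2 Y : mxtuple R g N, free_spectrahedron A N Y &
    l2norm (freepoly_eval Q X *m v) <= opnorm (freepoly_eval Q Y) * l2norm v.
Proof.
pose s := suffixes (finsupp Q).
exists (size s * l)%N => A n X v hX.
pose Z : 'M[C]_(n, size s * l) := \matrix_(a, c)
  (word_eval X (nth [::] s (mxtens_unindex c).1) *m unvec v) a (mxtens_unindex c).2.
have [V hV hZ] := pisom_range Z.
have rangeV w : w \in s ->
    V *m V ^t* *m (word_eval X w *m unvec v) = word_eval X w *m unvec v.
  move=> ws; have ltw : (index w s < size s)%N by rewrite index_mem.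
  (* G selects the block of columns of Z that belongs to the word w. *)
  pose G : 'M[C]_(size s * l, l) := \matrix_(c, b)
    (c == mxtens_index (Ordinal ltw, b))%:R.
  have ZG : Z *m G = word_eval X w *m unvec v.
    apply/matrixP => a b; rewrite mxE (bigD1 (mxtens_index (Ordinal ltw, b))) //=.
    rewrite big1 ?addr0 => [|c cb]; last by rewrite !mxE (negbTE cb) mulr0.
    by rewrite [Z _ _]mxE [G _ _]mxE eqxx mulr1 mxtens_indexK /= nth_index.
  by rewrite -ZG mulmxA hZ.
have hY : free_spectrahedron A (size s * l) (fun j => V ^t* *m X j *m V).
  exact: (spectrahedron_conj (pisom_complement hV)).
exists (fun j => V ^t* *m X j *m V) => //.
set Y := fun j => _.
have YX w : w \in s -> V *m word_eval Y w *m V ^t* *m unvec v = word_eval X w *m unvec v.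
  elim: w => [|j w IH] ws /=.
    by rewrite mulmx1 -[in RHS](rangeV _ ws) /= mul1mx.
  rewrite -(rangeV _ ws) /= -!mulmxA; congr (V *m (_ *m (X j *m _))).
  by rewrite -IH ?(suffixes_behead ws) // !mulmxA.
have nV : opnorm V <= 1 := opnorm_contraction (pisom_complement hV).
have nV' : opnorm (V ^t*) <= 1.
  apply/opnorm_contraction/pisom_complement.
  by rewrite trmxCK -{2}[V]trmxCK -!adjmx_mul mulmxA hV.
have -> : freepoly_eval Q X *m v =
    (1%:M *t V) *m (freepoly_eval Q Y *m ((1%:M *t V ^t*) *m v)).
  rewrite /freepoly_eval !mulmx_suml mulmx_sumr.
  apply: eq_big_seq => w wQ.
  rewrite (mulmxA (1%:M *t V)) mulmxA !tensmx_mul mul1mx mulmx1.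
  by apply: tens_mul_unvec; rewrite YX // mem_suffixes.
have c1 (m p q : nat) (M : 'M[C]_(m, p)) (u : 'cV[C]_(q * p)) :
    opnorm M <= 1 -> l2norm ((1%:M *t M) *m u) <= l2norm u.
  move=> hM; apply: le_trans (l2norm_mulmx _ _) _; rewrite -[leRHS]mul1r.
  by rewrite ler_wpM2r ?l2norm_ge0 // (le_trans (opnorm_1tens _ _)).
apply: le_trans (c1 _ _ _ _ _ nV) _; apply: le_trans (l2norm_mulmx _ _) _.
by rewrite ler_wpM2l ?opnorm_ge0 ?c1.
Qed.

End Compression.

(** * Compactness and uniform contractivity *)

Section Compactness.
Context {R : realType}.
Local Notation C := R[i].

(** Compactness of the box [-r, r]^I.  The local bounds are also asked at points
    outside D: this is where closedness of D enters, since a point with a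
    neighbourhood that misses D satisfies the condition trivially. *)
Lemma box_bound_lt1 (I : finType) (D : set (I -> R)) (h : (I -> R) -> R) (r : R) :
  (forall x, D x -> forall i, `|x i| <= r) ->
  (forall x, exists e s : R, [/\ 0 < e, s < 1 &
     forall y, D y -> (forall i, `|x i - y i| < e) -> h y <= s]) ->
  exists2 s : R, s < 1 & forall y, D y -> h y <= s.
Proof.
move=> Dr loc.
pose pt (x : 'rV[R]_(#|I|)) : I -> R := fun i => x 0 (enum_rank i).
have cK : compact [set x : 'rV[R]_(#|I|) | forall i, x ord0 i \in `[- r, r]].
  apply: (@rV_compact _ _ (fun=> `[- r, r]%classic)) => _.
  exact: segment_compact.
have bound_near : \forall s \near (1:R)^'-,
    [set x : 'rV[R]_(#|I|) | forall i, x ord0 i \in `[- r, r]] `<=`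
    [set x | D (pt x) -> h (pt x) <= s].
  apply: ((compact_near_coveringP _).1 cK R _ (fun s x => D (pt x) -> h (pt x) <= s)).
  move=> x _; have [e [s [e0 s1 he]]] := loc (pt x).
  exists (ball x e, [set t | s <= t]) => /=.
    split; first by apply/nbhs_ballP; exists e.
    exact: nbhs_left_ge.
  move=> [y t] /= [[_ xy] st] Dy.
  by apply: le_trans st; apply: he => // i; exact: xy.
near (1:R)^'- => s.
exists s; first by near: s; exact: nbhs_left_lt.
move=> y Dy.
have sub : [set x : 'rV[R]_(#|I|) | forall i, x ord0 i \in `[- r, r]] `<=`
    [set x | D (pt x) -> h (pt x) <= s] by near: s.
have yE : pt (\row_i y (enum_val i)) = y.
  by apply: funext => i; rewrite /pt mxE enum_rankK.
rewrite -yE; apply: sub; last by rewrite yE.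
by move=> i; rewrite mxE in_itv /= -ler_norml Dr.
Unshelve. all: by end_near. Qed.

Lemma normc_le_ReIm (z : C) : normc z <= `|complex.Re z| + `|complex.Im z|.
Proof.
rewrite -(ler_pXn2r (n := 2)) // ?nnegrE ?normc_ge0 ?addr_ge0 //.
rewrite normc_sqr sqrrD !real_normK ?num_real // [leRHS]addrAC.
by rewrite lerDl mulrn_wge0 // mulr_ge0.
Qed.

Lemma Re_le_normc (z : C) : `|complex.Re z| <= normc z.
Proof.
rewrite -(ler_pXn2r (n := 2)) // ?nnegrE ?normc_ge0 //.
by rewrite normc_sqr real_normK ?num_real // lerDl sqr_ge0.
Qed.

Variables (g d : nat) (A : mxtuple R g d).

(** The pencil is Hermitian for every X, so that membership in the
    spectrahedron is a family of real affine inequalities in X. *)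
Lemma spectrahedronP n (X : mxtuple R g n) :
  free_spectrahedron A n X <-> forall v : 'cV[C]_(d * n),
    0 <= l2norm v ^+ 2 + (complex.Re ((v ^t* *m homogeneous_pencil A X *m v) 0 0)) *+ 2.
Proof.
have E v : (v ^t* *m monic_pencil A X *m v) 0 0 =
   ((l2norm v ^+ 2 +
     (complex.Re ((v ^t* *m homogeneous_pencil A X *m v) 0 0)) *+ 2)%:C)%C.
  rewrite /monic_pencil !mulmxDr !mulmxDl mulmx1 [LHS]mxE [X in X + _]mxE -l2normE.
  set H := homogeneous_pencil A X.
  have -> : (v ^t* *m H ^t* *m v) 0 0 = conjc ((v ^t* *m H *m v) 0 0).
    have -> : v ^t* *m H ^t* *m v = (v ^t* *m H *m v) ^t*.
      by rewrite !adjmx_mul trmxCK mulmxA.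
    by rewrite !mxE.
  rewrite -addrA.
  by rewrite rmorphD; congr (_ + _); rewrite addcJ rmorphMn mulr_natl.
split=> [[_ psdX] v|h]; first by have := psdX v; rewrite E ler0c.
split; last by move=> v; rewrite E ler0c.
apply/hermsymP; rewrite /monic_pencil !adjmxD adjmx1 trmxCK -!addrA.
by congr (_ + _); rewrite addrC.
Qed.

(** Outside the spectrahedron one of these inequalities fails, and it keeps
    failing under small perturbations of X. *)
Lemma spectrahedron_compl_open n (X : mxtuple R g n) :
  ~ free_spectrahedron A n X -> exists2 e : R, 0 < e &
  forall Y : mxtuple R g n, (forall j, opnorm (X j - Y j) <= e) ->
    ~ free_spectrahedron A n Y.
Proof.
move=> /spectrahedronP /existsNP[v] /negP; rewrite -ltNge.
set q := fun X : mxtuple R g n =>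
  complex.Re ((v ^t* *m homogeneous_pencil A X *m v) 0 0).
rewrite -/(q X) => qX.
pose K := opnorm (v ^t*) * (\sum_j opnorm (A j)) * opnorm v.
have K0 : 0 <= K.
  by rewrite !mulr_ge0 ?opnorm_ge0 // sumr_ge0 // => j _; exact: opnorm_ge0.
have qlip (Y : mxtuple R g n) (e : R) : 0 <= e ->
    (forall j, opnorm (X j - Y j) <= e) -> `|q X - q Y| <= K * e.
  move=> e0 XY; rewrite /q -(raddfB (@complex.Re R : {additive Rcomplex R -> R})).
  apply: le_trans (Re_le_normc _) _.
  pose M := homogeneous_pencil A (fun j => X j - Y j).
  have -> : (v ^t* *m homogeneous_pencil A X *m v) 0 0 -
      (v ^t* *m homogeneous_pencil A Y *m v) 0 0 = (v ^t* *m M *m v) 0 0.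
    rewrite -[RHS](_ : (v ^t* *m homogeneous_pencil A X *m v -
      v ^t* *m homogeneous_pencil A Y *m v) 0 0 = _); first by rewrite !mxE.
    rewrite -mulmxBl -mulmxBr /M /homogeneous_pencil -sumrB.
    by under [in RHS]eq_bigr => j _ do rewrite tensmxBr.
  have hM : opnorm M <= (\sum_j opnorm (A j)) * e.
    apply: le_trans (opnorm_sum _ _) _; rewrite mulr_suml; apply: ler_sum => j _.
    apply: le_trans (opnorm_tens _ _) _.
    by apply: ler_wpM2l; [exact: opnorm_ge0|exact: XY].
  apply: le_trans (normc_entry_le _ _ _) _; apply: le_trans (opnormM _ _) _.
  rewrite /K mulrAC; apply: ler_wpM2r; first exact: opnorm_ge0.
  apply: le_trans (opnormM _ _) _; rewrite -mulrA.
  by apply: ler_wpM2l; first exact: opnorm_ge0.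
pose c := - (l2norm v ^+ 2 + q X *+ 2).
have c0 : 0 < c by rewrite oppr_gt0.
pose e := c / (4 * (K + 1)).
have e0 : 0 < e by rewrite divr_gt0 // mulr_gt0 // ltr_wpDl.
exists e => // Y XY /spectrahedronP/(_ v); rewrite -/(q Y) => qY.
have := qlip Y e (ltW e0) XY.
have Ke : K * e <= c / 4.
  have -> : c / 4 = (K + 1) * e.
    by rewrite /e; field; rewrite gt_eqF // ltr_wpDl.
  by rewrite ler_wpM2r ?lerDl // ltW.
by rewrite ler_norml => /andP[h1 h2]; move: c0 Ke h1 h2 qY; rewrite /c; lra.
Qed.

(** At a fixed size the spectrahedron is compact, hence a polynomial that is a
    strict contraction on it is uniformly so. *)
Lemma spectrahedron_freepoly_lt1 k l (Q : freepoly R g k l) n (r : R) : 0 <= r ->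
  (forall X : mxtuple R g n, free_spectrahedron A n X -> forall j, opnorm (X j) <= r) ->
  (forall X : mxtuple R g n, free_spectrahedron A n X -> opnorm (freepoly_eval Q X) < 1) ->
  exists2 s : R, s < 1 & forall X : mxtuple R g n,
    free_spectrahedron A n X -> opnorm (freepoly_eval Q X) <= s.
Proof.
move=> r0 hr hQ.
(* Real coordinates: the boolean selects real or imaginary parts. *)
pose I := ('I_g * 'I_n * 'I_n * bool)%type.
pose tup (x : I -> R) : mxtuple R g n := fun j =>
  \matrix_(a, b) Complex (x (j, a, b, true)) (x (j, a, b, false)).
pose coords (X : mxtuple R g n) : I -> R := fun i =>
  let z := X i.1.1.1 i.1.1.2 i.1.2 in if i.2 then complex.Re z else complex.Im z.
have tupK X : tup (coords X) = X.
  by apply: funext => j; apply/matrixP => a b; rewrite mxE /coords /=; case: (X j a b).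
pose D := [set x : I -> R | free_spectrahedron A n (tup x)].
pose c : R := (n * n)%:R * 2 + 1.
have c0 : 0 < c by rewrite ltr_wpDl // mulr_ge0.
have tup_lip x y (e : R) : 0 <= e -> (forall i, `|x i - y i| < e) ->
    forall j, opnorm (tup x j - tup y j) <= c * e.
  move=> e0 xy j; apply: le_trans (opnorm_le_entries _) _.
  apply: (@le_trans _ _ (\sum_(a < n) \sum_(b < n) (e *+ 2))).
    do 2![apply: ler_sum => ? _]; rewrite !mxE; apply: le_trans (normc_le_ReIm _) _.
    by rewrite /= mulr2n lerD // ltW.
  rewrite !sumr_const !card_ord -(mulr_natr (_ *+ n) n).
  rewrite -(mulr_natr (e *+ 2)) -(mulr_natr e) /c natrM.
  rewrite [leLHS](_ : _ = (n%:R * n%:R * 2) * e); last by ring.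
  by rewrite ler_wpM2r // lerDl.
have [||s s1 hs] := @box_bound_lt1 I D (fun x => opnorm (freepoly_eval Q (tup x))) r.
- move=> x Dx [[[j a] b] p].
  have := normc_entry_le (tup x j) a b; rewrite mxE => /le_trans/(_ (hr _ Dx j)).
  case: p; apply: le_trans; first exact: (Re_le_normc (Complex _ _)).
  rewrite -(ler_pXn2r (n := 2)) // ?nnegrE ?normc_ge0 //.
  by rewrite normc_sqr /= real_normK ?num_real // lerDr sqr_ge0.
- move=> x; have [Dx|nDx] := pselect (D x); last first.
    have [e e0 he] := spectrahedron_compl_open nDx.
    exists (e / c), 0; split=> [||y Dy xy]; [by rewrite divr_gt0|exact: ltr01|].
    case: (he (tup y) _ Dy) => j.
    have ce : c * (e / c) = e by rewrite mulrC divfK ?gt_eqF.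
    by have := tup_lip x y (e / c) (ltW (divr_gt0 e0 c0)) xy j; rewrite ce; exact.
  have [K K0 hK] := freepoly_lipschitz Q r0.
  set h := opnorm (freepoly_eval Q (tup x)).
  have h1 : 0 < 1 - h by rewrite subr_gt0 hQ.
  pose e := (1 - h) / (2 * (K * c + 1)).
  have Kc0 : 0 < K * c + 1 by rewrite ltr_wpDl // mulr_ge0 // ltW.
  have e0 : 0 < e by rewrite divr_gt0 // mulr_gt0.
  exists e, ((1 + h) / 2); split=> [||y Dy xy]; first exact: e0.
    by rewrite ltr_pdivrMr // mul1r; move: h1; lra.
  have := hK n (tup x) (tup y) (c * e) (ltW (mulr_gt0 c0 e0)) (hr _ Dx) (hr _ Dy)
    (tup_lip x y e (ltW e0) xy).
  have := opnormB (freepoly_eval Q (tup x))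
    (freepoly_eval Q (tup x) - freepoly_eval Q (tup y)).
  rewrite subKr -/h; move: (opnorm _) (opnorm _) => hxy hy le_y le_xy.
  have -> : (1 + h) / 2 = h + (K * c + 1) * e.
    by rewrite /e; field; rewrite gt_eqF.
  apply: (le_trans le_y); rewrite lerD2l; apply: (le_trans le_xy).
  by rewrite [leRHS]mulrDl mulrA mul1r lerDl ltW.
by exists s => // X hX; rewrite -(tupK X) hs // /D /= tupK.
Qed.

End Compactness.

(** Since the dimension in the compression argument is independent of the size
    of X, a polynomial that is a strict contraction on all levels of a bounded
    spectrahedron is so uniformly over all levels. *)
Lemma spectrahedron_freepoly_uniform_lt1 (R : realType) g d (A : mxtuple R g d)
    k l (Q : freepoly R g k l) (r : R) : 0 <= r ->
  (forall n (X : mxtuple R g n), free_spectrahedron A n X ->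
     forall j, opnorm (X j) <= r) ->
  (forall n (X : mxtuple R g n), free_spectrahedron A n X ->
     opnorm (freepoly_eval Q X) < 1) ->
  exists2 s : R, s < 1 & forall n (X : mxtuple R g n),
    free_spectrahedron A n X -> opnorm (freepoly_eval Q X) <= s.
Proof.
move=> r0 hr hQ; have [N hN] := freepoly_compress d Q.
have [s s1 hs] := spectrahedron_freepoly_lt1 r0 (hr N) (hQ N).
have s0 : 0 <= s.
  by apply: le_trans (hs _ (spectrahedron0 A N)); exact: opnorm_ge0.
exists s => // n X hX; apply: opnorm_le => // v.
have [Y hY le_v] := hN A n X v hX; apply: le_trans le_v _.
by rewrite ler_wpM2r ?l2norm_ge0 ?hs.
Qed.

(** * Newton interpolation of free functions *)

Section Newton.
Context {R : realType}.
Local Notation C := R[i].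

(** For t constant this is a Jordan block, rescaled by K off the diagonal. *)
Definition newton_mx (K : R) (t : nat -> R) p : 'M[C]_p.+1 :=
  diag_mx (\row_i ((t i)%:C)%C) + (K%:C)%C *: \matrix_(i, j) (j == i.+1 :> nat)%:R.

(** The scaling by K matches the superdiagonal of [newton_mx]. *)
Definition newton_poly (K : R) (t : nat -> R) (x : R) (i : nat) : R :=
  \prod_(j < i) ((x - t j) / K).

Definition newton_vec (K : R) (t : nat -> R) p (x : R) : 'cV[C]_p.+1 :=
  \col_i ((newton_poly K t x i)%:C)%C.

Lemma newton_polyS K t x i : K != 0 ->
  K * newton_poly K t x i.+1 = (x - t i) * newton_poly K t x i.
Proof. by move=> K0; rewrite /newton_poly big_ord_recr /=; field. Qed.

Lemma newton_mx_mul K t p (v : nat -> C) (i : 'I_p.+1) :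
  (newton_mx K t p *m \col_j v j) i 0 =
  ((t i)%:C)%C * v i + (if (i < p)%N then (K%:C)%C * v i.+1 else 0).
Proof.
rewrite mulmxDl -scalemxAl mxE; congr (_ + _); first by rewrite mul_diag_mx !mxE.
rewrite mxE [X in _ * X]mxE; case: ltnP => ip; last first.
  rewrite big1 ?mulr0 // => j _; rewrite !mxE.
  by case: eqP => [ji|]; rewrite ?mul0r //; have := ltn_ord j; rewrite ji ltnS ltnNge ip.
have i1 : (i.+1 < p.+1)%N by [].
rewrite (bigD1 (Ordinal i1)) //= big1 ?addr0 => [|j ji]; first by rewrite !mxE eqxx mul1r.
by rewrite !mxE -(inj_eq val_inj) /= in ji *; rewrite (negbTE ji) mul0r.
Qed.

(** The Newton polynomials at a node are an eigenvector of the bidiagonal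
    matrix of the nodes: this is the recurrence between them, the last row
    holding because the full product vanishes at a node. *)
Lemma newton_eigen K t p k : K != 0 -> (k <= p)%N ->
  newton_mx K t p *m newton_vec K t p (t k) = ((t k)%:C)%C *: newton_vec K t p (t k).
Proof.
move=> K0 kp; apply/matrixP => i j; rewrite ord1 {j}.
rewrite (newton_mx_mul K t (fun i => ((newton_poly K t (t k) i)%:C)%C)) !mxE.
case: ltnP => ip.
  by rewrite -!rmorphM newton_polyS // -rmorphD /=; congr (_ %:C)%C; ring.
have {}ip : nat_of_ord i = p by apply/eqP; rewrite eqn_leq ip -ltnS ltn_ord.
have : (t k - t p) * newton_poly K t (t k) p = 0.
  rewrite -newton_polyS // /newton_poly (bigD1 (Ordinal (kp : (k < p.+1)%N))) //=.
  by rewrite subrr mul0r mul0r mulr0.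
move=> E; rewrite addr0 ip -!rmorphM /=; congr (_ %:C)%C.
by apply/eqP; rewrite eq_sym -subr_eq0 -mulrBl E.
Qed.

(** For distinct nodes the eigenvectors form a basis. The coefficients of the
    last basis vector are those of the divided difference at the nodes. *)
Lemma newton_divided_difference K t p : K != 0 ->
  (forall i j, (i < j <= p)%N -> t i != t j) ->
  exists2 c : nat -> C,
    \sum_(k < p.+1) c k *: newton_vec K t p (t k) = delta_mx ord_max 0 &
    c p * ((newton_poly K t (t p) p)%:C)%C = 1.
Proof.
move=> K0 tinj.
pose M : 'M[C]_p.+1 := \matrix_(k, i) ((newton_poly K t (t k) i)%:C)%C.
have M0 (k i : 'I_p.+1) : (k < i)%N -> M k i = 0.
  move=> ki; rewrite mxE /newton_poly (bigD1 (Ordinal ki)) //=.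
  by rewrite subrr !mul0r.
have Munit : M \in unitmx.
  rewrite unitmxE unitfE det_trig; last by apply/is_trig_mxP => k i /M0.
  apply/prodf_neq0 => i _; rewrite mxE eq_complex /= eqxx andbT.
  apply/prodf_neq0 => j _; rewrite mulf_neq0 ?invr_eq0 // subr_eq0 eq_sym.
  by apply: tinj; rewrite ltn_ord -ltnS ltn_ord.
pose c : 'rV[C]_p.+1 := delta_mx 0 ord_max *m invmx M.
have cM : c *m M = delta_mx 0 ord_max by rewrite mulmxKV.
exists (fun k => c 0 (inord k)).
  apply/matrixP => i j; rewrite ord1 {j} summxE.
  transitivity ((c *m M) 0 i).
    by rewrite mxE; apply: eq_bigr => k _; rewrite !mxE inord_val.
  by rewrite cM !mxE eqxx andbT.
have /matrixP/(_ 0 ord_max) := cM; rewrite [LHS]mxE (bigD1 ord_max) //= big1 => [|k kp].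
  rewrite addr0 [RHS]mxE !eqxx mulr1n [M _ _]mxE => <-; congr (c 0 _ * _).
  by apply: val_inj; rewrite /= inordK.
rewrite M0 ?mulr0 //= ltn_neqAle -ltnS ltn_ord andbT.
by rewrite -(inj_eq val_inj) in kp.
Qed.

End Newton.

Section FreeFunctionBlocks.
Context {R : realType} {g k l : nat}.
Local Notation C := R[i].
Variables (D : levelset R g) (f : graded_fun R g k l) (B : R).
Hypotheses (f_free : free_function D f)
  (f_bounded : forall n (X : mxtuple R g n), D X -> opnorm (f X) <= B).

Definition scale_tuple n (x : R) (X : mxtuple R g n) : mxtuple R g n :=
  fun j => (x%:C)%C *: X j.

Definition amplify p n (T : 'M[C]_p) (X : mxtuple R g n) : mxtuple R g (p * n) :=
  fun j => T *t X j.

(** Seen as a (p+1) x (p+1) array of k n x l n blocks, F is contracted with the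
    first basis vector on the left and with c on the right.  For a basis vector
    c this is a single block, hence bounded by the norm of F; for an eigenvector c it is a
    value of the free function. *)
Definition first_row p n (F : 'M[C]_(k * (p.+1 * n), l * (p.+1 * n)))
    (c : 'cV[C]_p.+1) : 'M[C]_(k * n, l * n) :=
  (1%:M *t (vtens (delta_mx 0 0) n) ^t*) *m F *m (1%:M *t vtens c n).

Lemma first_rowD p n (F : 'M[C]_(k * (p.+1 * n), l * (p.+1 * n))) c c' :
  first_row F (c + c') = first_row F c + first_row F c'.
Proof. by rewrite /first_row vtensD tensmxDr mulmxDr. Qed.

Lemma first_rowZ p n (F : 'M[C]_(k * (p.+1 * n), l * (p.+1 * n))) z c :
  first_row F (z *: c) = z *: first_row F c.
Proof. by rewrite /first_row vtensZ tensmxZr -scalemxAr. Qed.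

Lemma first_row_sum p n (F : 'M[C]_(k * (p.+1 * n), l * (p.+1 * n)))
    (I : Type) (s : seq I) (c : I -> 'cV_p.+1) :
  first_row F (\sum_(i <- s) c i) = \sum_(i <- s) first_row F (c i).
Proof. by rewrite /first_row vtens_sum tensmx_sumr mulmx_sumr. Qed.

Lemma adj_delta_mul p (i : 'I_p.+1) (v : 'cV[C]_p.+1) :
  ((delta_mx i 0 : 'cV[C]_p.+1) ^t* *m v) 0 0 = v i 0.
Proof. by rewrite trmx_delta map_delta_mx -rowE mxE. Qed.

Lemma opnorm_vtens_delta p n (i : 'I_p.+1) :
  opnorm (vtens (delta_mx i 0 : 'cV[C]_p.+1) n) <= 1 /\
  opnorm ((vtens (delta_mx i 0 : 'cV[C]_p.+1) n) ^t*) <= 1.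
Proof.
set V := vtens _ n.
have VV : V ^t* *m V = 1%:M by rewrite adj_vtens_mul adj_delta_mul mxE !eqxx.
split; apply: opnorm_contraction (pisom_complement _); first by rewrite -mulmxA VV mulmx1.
by rewrite trmxCK VV mul1mx.
Qed.

Lemma opnorm_first_row p n (F : 'M[C]_(k * (p.+1 * n), l * (p.+1 * n))) i :
  opnorm (first_row F (delta_mx i 0)) <= opnorm F.
Proof.
have [h _] := opnorm_vtens_delta n i.
have [_ h0] := @opnorm_vtens_delta p n 0.
apply: le_trans (opnormM _ _) _; rewrite -[leRHS]mulr1.
apply: ler_pM; [exact: opnorm_ge0|exact: opnorm_ge0| |].
  apply: le_trans (opnormM _ _) _; rewrite -[leRHS]mul1r.
  by apply: ler_wpM2r; [exact: opnorm_ge0|apply: le_trans (opnorm_1tens _ _) h0].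
exact: le_trans (opnorm_1tens _ _) h.
Qed.

(** An eigenvector v of T intertwines the tuple T (x) X with x X. *)
Lemma first_row_eigen p n (T : 'M[C]_p.+1) (X : mxtuple R g n) (x : R) v :
  D (amplify T X) -> D (scale_tuple x X) -> T *m v = (x%:C)%C *: v ->
  first_row (f (amplify T X)) v = v 0 0 *: f (scale_tuple x X).
Proof.
move=> DT Dx Tv; rewrite /first_row -mulmxA (f_free DT Dx); last first.
  by move=> j; rewrite tens_mul_vtens Tv vtensZ -scalemxAl -scalemxAr.
rewrite mulmxA mul1tens adj_vtens_mul adj_delta_mul.
by rewrite -[(v 0 0)%:M]scalemx1 tensmxZr tens1mx1 -scalemxAl mul1mx.
Qed.

(** Newton interpolation.  The remainder is a divided difference, that is, up
    to the scaling of the superdiagonal, a block of f at a single point. *)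
Lemma newton_interpolation (K : R) (t : nat -> R) p : K != 0 ->
  (forall i j, (i < j <= p)%N -> t i != t j) ->
  exists c : nat -> C, forall n (X : mxtuple R g n),
    D (amplify (newton_mx K t p) X) ->
    (forall i, (i <= p)%N -> D (scale_tuple (t i) X)) ->
    opnorm (f (scale_tuple (t p) X) - \sum_(i < p) c i *: f (scale_tuple (t i) X))
      <= `|newton_poly K t (t p) p| * B.
Proof.
move=> K0 tinj; have [c csum cp] := newton_divided_difference K0 tinj.
set w := ((newton_poly K t (t p) p)%:C)%C in cp.
exists (fun i => - (w * c i)) => n X DT Dt.
have E : f (scale_tuple (t p) X) - \sum_(i < p) - (w * c i) *: f (scale_tuple (t i) X)
    = w *: first_row (f (amplify (newton_mx K t p) X)) (delta_mx ord_max 0).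
  rewrite -csum first_row_sum big_ord_recr /= scalerDr scaler_sumr addrC -sumrN.
  have v0 x : newton_vec K t p x 0 0 = 1 by rewrite mxE /newton_poly big_ord0.
  have Ek (i : nat) : (i <= p)%N -> w *: first_row (f (amplify (newton_mx K t p) X))
      (c i *: newton_vec K t p (t i)) = (w * c i) *: f (scale_tuple (t i) X).
    move=> ip; rewrite first_rowZ (first_row_eigen DT (Dt _ ip)) ?newton_eigen //.
    by rewrite v0 scale1r scalerA.
  congr (_ + _); last by rewrite Ek // mulrC cp scale1r.
  by apply: eq_bigr => i _; rewrite Ek 1?ltnW // scaleNr opprK.
rewrite E; apply: le_trans (opnormZ _ _) _; rewrite normc_real.
apply: ler_wpM2l; first exact: normr_ge0.
exact: le_trans (opnorm_first_row _ _) (f_bounded DT).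
Qed.

End FreeFunctionBlocks.

(** * Nilpotent points and Taylor approximation *)

Section Fock.
Context {R : realType} {g k l : nat}.
Local Notation C := R[i].
Variables (D : levelset R g) (f : graded_fun R g k l) (B : R).
Hypotheses (f_free : free_function D f)
  (f_bounded : forall n (X : mxtuple R g n), D X -> opnorm (f X) <= B).
Hypothesis D_near0 : exists2 e : R, 0 < e &
  forall n (X : mxtuple R g n), (forall j, opnorm (X j) <= e) -> D X.

(** The truncated left creation operators are universal among tuples with a
    vector that long words annihilate: an intertwiner carries the vacuum to this
    vector.  So the value of f at the creation operators, applied to the vacuum,
    determines f(Y) on u, and its blocks are the coefficients. *)
Lemma free_function_nilpotent_vec p : exists c : seq 'I_g -> 'M[C]_(k, l),
  forall m n (Y : mxtuple R g m) (u : 'M[C]_(m, n)), D Y ->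
    (forall w, size w = p.+1 -> word_eval Y w *m u = 0) ->
    f Y *m (1%:M *t u) = \sum_(w : {bseq p of 'I_g}) c w *t (word_eval Y w *m u).
Proof.
have [e e0 De] := D_near0.
pose N := #|{: {bseq p of 'I_g}}|.
pose wd (a : 'I_N) : seq 'I_g := val (enum_val a : {bseq p of 'I_g}).
pose rk (w : seq 'I_g) : 'I_N := enum_rank (insub_bseq p w).
have wdK w : (size w <= p)%N -> wd (rk w) = w.
  by move=> wp; rewrite /wd /rk enum_rankK /insub_bseq insubdK.
have rkK a : rk (wd a) = a.
  by rewrite /wd /rk /insub_bseq valKd enum_valK.
have wd_size a : (size (wd a) <= p)%N by exact: size_bseq.
pose r : R := e / (N * N).+1%:R.
have r0 : 0 < r by rewrite divr_gt0 // ltr0n.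
pose rC : C := (r%:C)%C.
have rC0 : rC != 0 by rewrite eq_complex /= eqxx andbT gt_eqF.
(* The creation operators are scaled by r so as to lie in D. *)
pose L : mxtuple R g N := fun j =>
  \matrix_(a, b) (if wd a == j :: wd b then rC else 0).
have DL : D L.
  apply: De => j; apply: le_trans (opnorm_le_entries _) _.
  apply: (@le_trans _ _ (\sum_(b < N) \sum_(a < N) r)).
    do 2![apply: ler_sum => ? _]; rewrite mxE; case: ifP => _.
      by rewrite normc_real ger0_norm // ltW.
    by rewrite normc0 ltW.
  rewrite !sumr_const !card_ord -mulrnA -mulr_natr /r mulrAC.
  by rewrite ler_pdivrMr ?ltr0n // ler_pM2l // ler_nat.
pose c (w : seq 'I_g) : 'M[C]_(k, l) := \matrix_(a, b)
  (rC ^- size w * f L (mxtens_index (a, rk w)) (mxtens_index (b, rk [::]))).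
exists c => m n Y u DY nilY.
have col_case (y : 'cV[C]_m) : (forall w, size w = p.+1 -> word_eval Y w *m y = 0) ->
    f Y *m ((1%:M : 'M[C]_l) *t y) =
    \sum_(w : {bseq p of 'I_g}) c w *t (word_eval Y w *m y).
  move=> nily.
  (* The intertwiner sends the basis vector of w to r^(-|w|) w(Y) y. *)
  pose G : 'M[C]_(m, N) := \matrix_(i, b)
    (rC ^- size (wd b) * (word_eval Y (wd b) *m y) i 0).
  have colG b : col b G = rC ^- size (wd b) *: (word_eval Y (wd b) *m y).
    by apply/matrixP => i j; rewrite ord1 !mxE.
  have GL j : Y j *m G = G *m L j.
    apply/matrixP => i b; transitivity ((Y j *m col b G) i 0).
      by rewrite !mxE; apply: eq_bigr => s _; rewrite [col b G _ _]mxE.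
    rewrite colG -scalemxAr mulmxA mxE [RHS]mxE.
    have [sb|sb] := ltnP (size (wd b)) p; last first.
      have -> : Y j *m word_eval Y (wd b) *m y = 0.
        apply: (nily (j :: wd b)) => /=; congr S.
        by apply/eqP; rewrite eqn_leq sb wd_size.
      rewrite mxE mulr0 big1 // => a _; rewrite [L _ _ _]mxE; case: eqP => [wa|].
        by have := wd_size a; rewrite wa /= ltnNge sb.
      by rewrite mulr0.
    rewrite (bigD1 (rk (j :: wd b))) //= big1 ?addr0 => [|a ab].
      rewrite [G _ _]mxE [L _ _ _]mxE wdK // eqxx /= exprS mulrAC.
      by congr (_ * _); rewrite invfM mulrAC mulVf // mul1r.
    rewrite [L _ _ _]mxE; case: eqP => [wa|]; last by rewrite mulr0.
    by move: ab; rewrite -wa rkK eqxx.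
  pose d : 'cV[C]_N := delta_mx (rk [::]) 0.
  have Gd : G *m d = y.
    by rewrite -colE colG wdK // expr0 invr1 scale1r /= mul1mx.
  rewrite -Gd -mul1tens mulmxA (f_free DY DL GL) -mulmxA.
  apply/matrixP => s t; case: (mxtens_indexP s) => a i.
  case: (mxtens_indexP t) => b o; rewrite ord1 {o t s} summxE.
  have fLd a' q : (f L *m (1%:M *t d)) (mxtens_index (a', q)) (mxtens_index (b, 0))
      = f L (mxtens_index (a', q)) (mxtens_index (b, rk [::])).
    rewrite mxE (bigD1 (mxtens_index (b, rk [::]))) //= big1 ?addr0.
      by rewrite tensmxE !mxE !eqxx !mulr1.
    move=> q' nq; case: (mxtens_indexP q') nq => b' e' nq.
    rewrite tensmxE !mxE; have [bb|_] := eqVneq b' b; last by rewrite mul0r mulr0.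
    have [ee|_] := eqVneq e' (rk [::]); last by rewrite /= mulr0 mulr0.
    by move: nq; rewrite bb ee eqxx.
  rewrite mxE sum_mxtens (bigD1 a) //= [X in _ + X]big1 ?addr0; last first.
    move=> a' na; rewrite big1 // => q _.
    by rewrite tensmxE [1%:M _ _]mxE eq_sym (negbTE na) !mul0r.
  rewrite [RHS](reindex (fun q : 'I_N => enum_val q)) /=; last first.
    by exists (fun w => enum_rank w) => w _; rewrite ?enum_valK ?enum_rankK.
  apply: eq_bigr => q _; rewrite fLd !tensmxE [1%:M _ _]mxE eqxx mul1r [G _ _]mxE.
  by rewrite [c _ _ _]mxE -/(wd q) rkK Gd mulrAC.
have uE (z : 'M[C]_(m, n)) : z = \sum_b col b z *m (delta_mx 0 b : 'rV[C]_n).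
  apply/matrixP => i b; rewrite summxE (bigD1 b) //= big1 ?addr0 => [|b' bb].
    by rewrite !mxE big_ord1 !mxE !eqxx mulr1.
  by rewrite !mxE big_ord1 !mxE eqxx eq_sym (negbTE bb) mulr0.
rewrite {1}(uE u) tensmx_sumr mulmx_sumr.
transitivity (\sum_b \sum_(w : {bseq p of 'I_g})
    c w *t (word_eval Y w *m col b u *m (delta_mx 0 b : 'rV[C]_n))).
  apply: eq_bigr => b _; rewrite -mul1tens mulmxA col_case => [|w wp].
    by rewrite mulmx_suml; apply: eq_bigr => w _; rewrite tensmx_mul mulmx1.
  by rewrite colE mulmxA nilY // mul0mx.
rewrite exchange_big; apply: eq_bigr => w _; rewrite -tensmx_sumr; congr (_ *t _).
rewrite [in RHS](uE u) mulmx_sumr.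
by apply: eq_bigr => b _; rewrite mulmxA.
Qed.

(** Newton interpolation with all nodes at 0, where the interpolant is the
    Taylor polynomial: the blocks of f at the amplification by a nilpotent
    Jordan block are polynomials. *)
Lemma taylor_approximation (K x : R) q : K != 0 ->
  let t i : R := if (i < q.+1)%N then 0 else x in
  exists s : seq (seq 'I_g * 'M[C]_(k, l)), forall n (X : mxtuple R g n),
    D (amplify (newton_mx K t q.+1) X) -> D (scale_tuple x X) ->
    opnorm (f (scale_tuple x X) - terms_eval s X) <= `|x / K| ^+ q.+1 * B.
Proof.
move=> K0 t; have [c hc] := free_function_nilpotent_vec q.
exists [seq (val w, ((x ^+ size w)%:C)%C *: c w) | w : {bseq q of 'I_g}].
move=> n X DT Dx; set p := q.+1; set T := newton_mx K t p.
have tp : t p = x by rewrite /t ltnn.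
(* Apart from its last coordinate, the eigenvector lies in the nilpotent part
   of T; z m is the image of this part under the m-th power of T. *)
pose z m : 'cV[C]_p.+1 := \col_(i < p.+1)
  (if (i + m < p)%N then ((x ^+ m * (x / K) ^+ i)%:C)%C else 0).
have Tz m : T *m z m = z m.+1.
  apply/matrixP => i j; rewrite ord1 {j} (newton_mx_mul K t
    (fun i => if (i + m < p)%N then ((x ^+ m * (x / K) ^+ i)%:C)%C else 0)) mxE /t.
  rewrite addnS; have [ip|ip] := ltnP i p; last first.
    have pim : (p <= i + m)%N by rewrite (leq_trans ip) ?leq_addr.
    by rewrite !ifF ?mulr0 ?addr0 //; apply: negbTE; rewrite -leqNgt // leqW.
  rewrite mul0r add0r addSn; case: ifP => _; last by rewrite mulr0.
  rewrite -rmorphM /=; congr (_ %:C)%C; rewrite !exprS.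
  by field.
have wz w : word_eval (amplify T X) w *m vtens (z 0) n =
    vtens (z (size w)) n *m word_eval X w.
  elim: w => [|j w IH] /=; first by rewrite mul1mx mulmx1.
  by rewrite -mulmxA IH mulmxA tens_mul_vtens Tz -mulmxA.
have vE : newton_vec K t p x = z 0 + (((x / K) ^+ p)%:C)%C *: delta_mx ord_max 0.
  apply/matrixP => i j; rewrite ord1 {j} !mxE addn0 expr0 mul1r eqxx andbT.
  have -> : newton_poly K t x i = (x / K) ^+ i.
    rewrite /newton_poly -[in RHS](card_ord i) -prodr_const.
    apply: eq_bigr => j _; rewrite /t (leq_trans (ltn_ord j)) ?subr0 //.
    by rewrite -ltnS.
  case: ltnP => ip.
    by rewrite -(inj_eq val_inj) /= ltn_eqF // mulr0 addr0.
  have {}ip : i = ord_max by apply: val_inj => /=; apply/eqP; rewrite eqn_leq ip -ltnS ltn_ord.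
  by rewrite ip eqxx mulr1 add0r.
have eigT : T *m newton_vec K t p x = (x%:C)%C *: newton_vec K t p x.
  by have := newton_eigen t K0 (leqnn p); rewrite tp.
have := first_row_eigen f_free DT Dx eigT.
rewrite [newton_vec _ _ _ _ 0 0]mxE /newton_poly big_ord0 scale1r => <-.
rewrite vE first_rowD first_rowZ.
have -> : first_row (f (amplify T X)) (z 0) =
    terms_eval [seq (val w, ((x ^+ size w)%:C)%C *: c w) | w : {bseq q of 'I_g}] X.
  rewrite /first_row -mulmxA hc // => [|w wq]; last first.
    have z0 : z p = 0 by apply/matrixP => i j; rewrite !mxE ltnNge leq_addl.
    by rewrite wz wq z0 -(scale0r (0 : 'cV[C]_p.+1)) vtensZ scale0r mul0mx.
  rewrite /terms_eval big_map big_enum mulmx_sumr; apply: eq_bigr => w _ /=.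
  rewrite tensmx_mul mul1mx wz mulmxA adj_vtens_mul adj_delta_mul mul_scalar_mx.
  rewrite tensmxZr -tensmxZl mxE add0n (leq_ltn_trans (size_bseq w)) //.
  by rewrite expr0 mulr1.
rewrite addrAC subrr add0r; apply: le_trans (opnormZ _ _) _.
rewrite normc_real normrX; apply: ler_wpM2l; first exact: exprn_ge0.
exact: le_trans (opnorm_first_row _ _) (f_bounded DT).
Qed.

End Fock.

(** * Continuation along segments *)

Section Approximation.
Context {R : realType} {g d : nat}.
Local Notation C := R[i].
Variable A : mxtuple R g d.

Lemma spectrahedron_scale n (x : R) (X : mxtuple R g n) : 0 <= x <= 1 ->
  free_spectrahedron A n X -> free_spectrahedron A _ (scale_tuple x X).
Proof.
move=> /andP[x0 x1] hX.
have adjs (y : R) m : ((((y%:C)%C)%:M : 'M[C]_m) ^t*) = ((y%:C)%C)%:M.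
  by rewrite tr_scalar_mx map_scalar_mx; congr (_%:M); exact: conjc_real.
have sq (y : R) m : 0 <= y ->
    (((Num.sqrt y)%:C)%C)%:M *m (((Num.sqrt y)%:C)%C)%:M = ((y%:C)%C)%:M :> 'M[C]_m.
  by move=> y0; rewrite -scalar_mxM -rmorphM -expr2 sqr_sqrtr.
pose V (y : R) : 'M[C]_n := (((Num.sqrt y)%:C)%C)%:M.
have VW : (V x) ^t* *m V x + (V (1 - x)) ^t* *m V (1 - x) = 1%:M.
  rewrite /V !adjs !sq ?subr_ge0 // -raddfD -rmorphD /=.
  by rewrite addrC subrK.
have := spectrahedron_conj VW hX; congr (free_spectrahedron A n _).
apply: funext => j; rewrite /V adjs mul_mx_scalar mul_scalar_mx scalerA.
by rewrite -rmorphM -expr2 sqr_sqrtr.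
Qed.

Lemma opnorm_shift p :
  opnorm (\matrix_(i < p.+1, j < p.+1) (j == i.+1 :> nat)%:R : 'M[C]_p.+1) <= 1.
Proof.
set S := \matrix_(i, j) _.
have S0 i j : S i j = (j == i.+1 :> nat)%:R by rewrite mxE.
apply: opnorm_le => // v; apply: l2norm_le_sqr => //; rewrite expr1n mul1r.
rewrite !l2norm_sqr big_ord_recr [leRHS]big_ord_recl /= addrC; apply: lerD.
  rewrite mxE big1 => [|j _]; first by rewrite normc0 expr0n sqr_ge0.
  by rewrite S0 /= ltn_eqF ?mul0r.
apply: ler_sum => i _; rewrite mxE (bigD1 (lift ord0 i)) //= big1 ?addr0.
  by rewrite S0 /= eqxx mul1r.
move=> j ji; rewrite S0 /=; case: eqP => [jE|]; last by rewrite mul0r.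
by move: ji; rewrite -(inj_eq val_inj) /= jE eqxx.
Qed.

Section Pseudoconvex.
Context {kQ lQ : nat}.
Variables (Q : freepoly R g kQ lQ) (r s : R).
Hypotheses (r0 : 0 <= r) (s1 : s < 1).
Hypothesis A_le : forall n (X : mxtuple R g n), free_spectrahedron A n X ->
  forall j, opnorm (X j) <= r.
Hypothesis Q_le : forall n (X : mxtuple R g n), free_spectrahedron A n X ->
  opnorm (freepoly_eval Q X) <= s.

(** Uniform strict contractivity and the uniform Lipschitz constant L leave room
    for a perturbation of size b e as soon as L b e < 1 - s. *)
Lemma pseudoconvex_nbhs (b : R) : 0 <= b -> exists e : R, [/\ 0 < e, e <= 1 &
  forall n (X Y : mxtuple R g n), free_spectrahedron A n X ->
    (forall j, opnorm (X j - Y j) <= b * e) -> pseudoconvex_set Q n Y].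
Proof.
move=> b0; have rb0 : 0 <= r + b by rewrite addr_ge0.
have [L L0 hL] := freepoly_lipschitz Q rb0.
have Lb0 : 0 <= L * b by rewrite mulr_ge0.
pose c := 1 - s + L * b.
have c0 : 0 < c by rewrite ltr_wpDr // subr_gt0.
have e0 : 0 < (1 - s) / c by rewrite divr_gt0 // subr_gt0.
have e1 : (1 - s) / c <= 1 by rewrite ler_pdivrMr // mul1r /c lerDl.
exists ((1 - s) / c); split=> //.
set e := (1 - s) / c in e0 e1 * => n X Y hX XY.
have be0 : 0 <= b * e by rewrite mulr_ge0 // ltW.
have XY' j : opnorm (X j - Y j) <= b by apply: le_trans (XY j) _; rewrite ler_piMr.
have X_le j : opnorm (X j) <= r + b by apply: le_trans (A_le hX j) _; rewrite lerDl.
have Y_le j : opnorm (Y j) <= r + b.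
  have := opnormB (X j) (X j - Y j); rewrite subKr => /le_trans; apply.
  by apply: lerD; [exact: A_le|exact: XY'].
have := hL n X Y (b * e) be0 X_le Y_le XY.
have := opnormB (freepoly_eval Q X) (freepoly_eval Q X - freepoly_eval Q Y).
rewrite subKr /pseudoconvex_set /=.
have := Q_le hX; have : L * (b * e) < 1 - s.
  rewrite mulrA /e mulrA ltr_pdivrMr // mulrC ltr_pM2l ?subr_gt0 //.
  by rewrite /c ltr_pwDl // subr_gt0.
move: (opnorm _) (opnorm _) (opnorm _) => x y z; lra.
Qed.

Lemma pseudoconvex_near0 : exists2 e : R, 0 < e &
  forall n (X : mxtuple R g n), (forall j, opnorm (X j) <= e) -> pseudoconvex_set Q n X.
Proof.
have [e [e0 _ he]] := pseudoconvex_nbhs (b := 1) ler01.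
exists e => // n X hX; apply: (he n (fun=> 0)); first exact: spectrahedron0.
by move=> j; rewrite sub0r opnormN mul1r.
Qed.

(** The tuple is a perturbation, of size at most r K, of the direct sum of the
    points t_i X of the spectrahedron.  That K does not depend on the number of
    nodes is what makes the interpolation error decay geometrically. *)
Lemma pseudoconvex_newton : exists2 K : R, 0 < K &
  forall n (X : mxtuple R g n) p (t : nat -> R), free_spectrahedron A n X ->
    (forall i, (i <= p)%N -> 0 <= t i <= 1) ->
    pseudoconvex_set Q _ (amplify (newton_mx K t p) X).
Proof.
have [K [K0 _ hK]] := pseudoconvex_nbhs r0.
exists K => // n X p t hX ht.
have hD : free_spectrahedron A _ (fun j => diag_mx (\row_(i < p.+1) ((t i)%:C)%C) *t X j).
  by apply: (spectrahedron_diag (t := fun i : 'I_p.+1 => t i)) => // i; apply: ht; rewrite -ltnS.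
apply: hK hD _ => j; rewrite /amplify /newton_mx tensmxDl opprD addrA subrr sub0r.
rewrite opnormN tensmxZl; apply: le_trans (opnormZ _ _) _.
rewrite normc_real gtr0_norm // mulrC; apply: ler_wpM2r; first exact: ltW.
apply: le_trans (opnorm_tens _ _) _; rewrite -[leRHS]mul1r.
by apply: ler_pM; [exact: opnorm_ge0|exact: opnorm_ge0|exact: opnorm_shift|exact: A_le].
Qed.

End Pseudoconvex.

Section Approximable.
Context {k l : nat}.
Implicit Type h : graded_fun R g k l.

(** The terms are chosen before the level n, so approximation is uniform over
    all levels. *)
Definition approximable h := forall e : R, 0 < e ->
  exists s : seq (seq 'I_g * 'M[C]_(k, l)), forall n (X : mxtuple R g n),
    free_spectrahedron A n X -> opnorm (h n X - terms_eval s X) <= e.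

Lemma approximableD h h' : approximable h -> approximable h' ->
  approximable (fun n X => h n X + h' n X).
Proof.
move=> ha ha' e e0; have e20 : 0 < e / 2 by rewrite divr_gt0.
have [s hs] := ha _ e20; have [s' hs'] := ha' _ e20.
exists (s ++ s') => n X hX; rewrite /terms_eval big_cat /= opprD addrACA.
apply: le_trans (opnormD _ _) _; rewrite [e in leRHS]splitr.
by apply: lerD; [exact: hs|exact: hs'].
Qed.

Lemma approximableZ c h : approximable h -> approximable (fun n X => c *: h n X).
Proof.
move=> ha e e0; have c1 : 0 < normc c + 1 by rewrite ltr_wpDl // normc_ge0.
have [s hs] := ha _ (divr_gt0 e0 c1).
exists [seq (t.1, c *: t.2) | t <- s] => n X hX.
have -> : terms_eval [seq (t.1, c *: t.2) | t <- s] X = c *: terms_eval s X.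
  rewrite /terms_eval big_map scaler_sumr; apply: eq_bigr => t _.
  by rewrite tensmxZl.
rewrite -scalerBr; apply: le_trans (opnormZ _ _) _.
have -> : e = (normc c + 1) * (e / (normc c + 1)) by rewrite mulrC divfK // gt_eqF.
apply: ler_pM; [exact: normc_ge0|exact: opnorm_ge0|by rewrite lerDl|exact: hs].
Qed.

Lemma approximable_sum p (h : nat -> graded_fun R g k l) :
  (forall i, (i < p)%N -> approximable (h i)) ->
  approximable (fun n X => \sum_(i < p) h i n X).
Proof.
elim: p => [|p IH] ha.
  move=> e e0; exists [::] => n X _.
  by rewrite big_ord0 /terms_eval big_nil subr0 opnorm0 ltW.
have hp : approximable (h p) by exact: ha.
have hs : approximable (fun n X => \sum_(i < p) h i n X).
  by apply: IH => i ip; apply: ha; exact: leqW.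
move=> e e0; have [s hs'] := approximableD hs hp e0.
by exists s => n X hX; rewrite big_ord_recr; exact: hs'.
Qed.

Lemma approximable_lim h :
  (forall e : R, 0 < e -> exists2 h', approximable h' &
     forall n (X : mxtuple R g n), free_spectrahedron A n X ->
       opnorm (h n X - h' n X) <= e) -> approximable h.
Proof.
move=> ha e e0; have e20 : 0 < e / 2 by rewrite divr_gt0.
have [h' ha' hh'] := ha _ e20; have [s hs] := ha' _ e20.
exists s => n X hX.
have -> : h n X - terms_eval s X = (h n X - h' n X) + (h' n X - terms_eval s X).
  by rewrite addrA subrK.
apply: le_trans (opnormD _ _) _; rewrite [e in leRHS]splitr.
by apply: lerD; [exact: hh'|exact: hs].
Qed.

Lemma halves_le (B e : R) : 0 <= B -> 0 < e ->
  exists p : nat, (2^-1) ^+ p.+1 * B <= e.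
Proof.
move=> B0 e0; have Be : 0 <= B / e by rewrite divr_ge0 // ltW.
exists (Num.bound (B / e)); set p := Num.bound _.
have hp : B / e < p%:R := archi_boundP Be.
have h2 : B / e <= 2 ^+ p.+1.
  apply: le_trans (ltW hp) _; rewrite -natrX ler_nat.
  by apply/ltnW/(leq_trans (ltn_expl p (ltnSn 1))); rewrite leq_exp2l.
rewrite exprVn mulrC ler_pdivrMr ?exprn_gt0 //.
by rewrite mulrC -ler_pdivrMr.
Qed.

Variables (D : levelset R g) (f : graded_fun R g k l) (B K : R).
Hypotheses (f_free : free_function D f) (B0 : 0 <= B)
  (f_bounded : forall n (X : mxtuple R g n), D X -> opnorm (f X) <= B).
Hypothesis D_near0 : exists2 e : R, 0 < e &
  forall n (X : mxtuple R g n), (forall j, opnorm (X j) <= e) -> D X.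
Hypothesis A_sub : forall n (X : mxtuple R g n), free_spectrahedron A n X -> D X.
Hypothesis K0 : 0 < K.
Hypothesis D_newton : forall n (X : mxtuple R g n) p (t : nat -> R),
  free_spectrahedron A n X -> (forall i, (i <= p)%N -> 0 <= t i <= 1) ->
  D (amplify (newton_mx K t p) X).

Let D_scale n (X : mxtuple R g n) x :
  free_spectrahedron A n X -> 0 <= x <= 1 -> D (scale_tuple x X).
Proof. by move=> hX x01; apply: A_sub; exact: spectrahedron_scale. Qed.

Lemma approximable_start x : 0 <= x <= 1 -> x <= K / 2 ->
  approximable (fun n X => f (scale_tuple x X)).
Proof.
move=> x01 xK e e0; have [q hq] := halves_le B0 e0.
have Kn0 : K != 0 by rewrite gt_eqF.
have [s hs] := taylor_approximation f_free f_bounded D_near0 x q Kn0.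
exists s => n X hX; apply: le_trans (hs n X _ _) _.
- apply: D_newton => // i _; case: ifP => _ //; by rewrite lexx ler01.
- exact: D_scale.
apply: le_trans hq; apply: ler_wpM2r => //.
rewrite ler_pXn2r ?nnegrE ?invr_ge0 //.
case/andP: x01 => x0 _.
have -> : `|x / K| = x / K by rewrite ger0_norm // divr_ge0 // ltW.
by rewrite ler_pdivrMr // mulrC.
Qed.

(** The nodes lie in [x - K / 2, x - K / 4]: close enough to x for the error to
    be at most B / 2^p, and far enough for x to have moved past them by K / 4. *)
Lemma approximable_step (a x : R) : K / 2 <= x -> x <= 1 -> x <= a + K / 4 ->
  (forall y, 0 <= y <= 1 -> y <= a -> approximable (fun n X => f (scale_tuple y X))) ->
  approximable (fun n X => f (scale_tuple x X)).
Proof.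
move=> Kx x1 xa IH; apply: approximable_lim => e e0.
have Kn0 : K != 0 by rewrite gt_eqF.
have x0 : 0 <= x by apply: le_trans Kx; rewrite divr_ge0 // ltW.
have [q hq] := halves_le B0 e0; set p := q.+1 in hq.
pose th (i : nat) : R := i%:R / p%:R.
have p0 : 0 < p%:R :> R by rewrite ltr0n.
have th01 i : (i < p)%N -> 0 <= th i <= 1.
  by move=> ip; rewrite /th divr_ge0 //= ler_pdivrMr // mul1r ler_nat ltnW.
have Kth i : (i < p)%N -> 0 <= K * th i /\ K * th i <= K.
  by move=> /th01/andP[h1 h2]; rewrite mulr_ge0 ?ler_piMr // ltW.
pose t (i : nat) : R := if (i < p)%N then x - K / 4 * (1 + th i) else x.
have tE i : (i < p)%N -> t i = x - K / 4 * (1 + th i) by rewrite /t => ->.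
have tp : t p = x by rewrite /t ltnn.
have t_ineq i : (i < p)%N -> 0 <= t i /\ t i <= x - K / 4.
  by move=> ip; rewrite tE //; have [h1 h2] := Kth _ ip; split; lra.
have t01 i : (i <= p)%N -> 0 <= t i <= 1.
  rewrite leq_eqVlt => /orP[/eqP ->|ip]; first by rewrite tp x0.
  have [h1 h2] := t_ineq _ ip; rewrite h1 /=; apply: (le_trans h2).
  by apply: le_trans x1; rewrite lerBlDr lerDl ltW // divr_gt0.
have tinj i j : (i < j <= p)%N -> t i != t j.
  move=> /andP[ij]; rewrite leq_eqVlt => /orP[/eqP jp|jp].
    rewrite jp tp; rewrite jp in ij; have [_ h] := t_ineq _ ij.
    by rewrite lt_eqF // (le_lt_trans h) // ltrBlDr ltrDl divr_gt0.
  have ip := ltn_trans ij jp; rewrite !tE // gt_eqF //.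
  rewrite ltrD2l ltrN2 ltr_pM2l ?divr_gt0 // ltrD2l /th ltr_pM2r ?invr_gt0 //.
  by rewrite ltr_nat.
have [c hc] := newton_interpolation f_free f_bounded Kn0 tinj.
exists (fun n X => \sum_(i < p) c i *: f (scale_tuple (t i) X)).
  apply: (approximable_sum (h := fun i n X => c i *: f (scale_tuple (t i) X))) => i ip.
  apply: approximableZ; apply: IH; first by apply: t01; exact: ltnW.
  have [_ h] := t_ineq _ ip; apply: (le_trans h).
  by rewrite lerBlDr.
move=> n X hX; rewrite -{1}tp; apply: le_trans (hc n X _ _) _.
- exact: D_newton.
- by move=> i ip; apply: D_scale => //; exact: t01.
apply: le_trans hq; apply: ler_wpM2r => //.
rewrite /newton_poly normr_prod.
have -> : (2^-1) ^+ p = \prod_(i < p) (2^-1 : R) by rewrite prodr_const card_ord.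
apply: ler_prod => i _; rewrite normr_ge0 /= tp tE //.
have [h1 h2] := Kth _ (ltn_ord i).
rewrite subKr ger0_norm; first by rewrite ler_pdivrMr //; lra.
by rewrite divr_ge0 ?ltW //; lra.
Qed.

Lemma approximable_scale x : 0 <= x <= 1 ->
  approximable (fun n X => f (scale_tuple x X)).
Proof.
have step m y : 0 <= y <= 1 -> y <= K / 2 + m%:R * (K / 4) ->
    approximable (fun n X => f (scale_tuple y X)).
  elim: m y => [|m IH] y y01 yle.
    by apply: approximable_start => //; rewrite mul0r addr0 in yle.
  have [yK|yK] := leP y (K / 2); first exact: approximable_start.
  case/andP: y01 => y0 y1.
  apply: (approximable_step (ltW yK) y1 _ IH).
  by rewrite -[m.+1%:R]natr1 mulrDl mul1r addrA in yle.
move=> x01; have K4 : 0 < K / 4 by rewrite divr_gt0.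
apply: (step (Num.bound (K / 4)^-1)) => //; case/andP: x01 => _ x1.
have := @archi_boundP R (K / 4)^-1; rewrite invr_ge0 (ltW K4) => /(_ isT).
set m := Num.bound _ => hm.
have : 1 <= m%:R * (K / 4) by rewrite -ler_pdivrMr // mul1r ltW.
by lra.
Qed.

End Approximable.
End Approximation.

Theorem theorem1p8 (R : realType) (g d : nat) (A : mxtuple R g d)
    (hA : free_bounded (free_spectrahedron A))
    (kQ lQ : nat) (Q : freepoly R g kQ lQ)
    (hsub : forall (n : nat) (X : mxtuple R g n),
        free_spectrahedron A n X -> pseudoconvex_set Q n X)
    (k l : nat) (f : graded_fun R g k l)
    (hfree : free_function (pseudoconvex_set Q) f)
    (hanalytic : analytic_on (pseudoconvex_set Q) f)
    (hbounded : bounded_fun_on (pseudoconvex_set Q) f) :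
  poly_approximable_on (free_spectrahedron A) f.
Proof.
have [N hN] := hA; pose r := Num.max 0 N.
have r0 : 0 <= r by rewrite le_max lexx.
have A_le n (X : mxtuple R g n) : free_spectrahedron A n X ->
    forall j, opnorm (X j) <= r.
  move=> hX j; apply: (@le_trans _ _ (tuple_norm X)).
    exact: (le_bigmax _ (fun j => opnorm (X j))).
  by rewrite le_max hN // orbT.
have [s s1 Q_le] := spectrahedron_freepoly_uniform_lt1 r0 A_le hsub.
have near0 := pseudoconvex_near0 r0 s1 A_le Q_le.
have [K K0 hK] := pseudoconvex_newton r0 s1 A_le Q_le.
have [B hB] := hbounded; pose B' := Num.max 0 B.
have B0 : 0 <= B' by rewrite le_max lexx.
have hB' n (X : mxtuple R g n) : pseudoconvex_set Q n X -> opnorm (f n X) <= B'.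
  by move=> hX; rewrite le_max hB ?orbT.
have /= approx1 := approximable_scale hfree B0 hB' near0 hsub K0 hK (x := 1).
move=> e e0; have e20 : 0 < e / 2 by rewrite divr_gt0.
have [|t ht] := approx1 _ _ e20; first by rewrite ler01 lexx.
have [q hq] := freepoly_of_terms t.
exists q => n X hX; rewrite hq; have := ht n X hX.
have -> : scale_tuple 1 X = X by apply: funext => j; rewrite /scale_tuple scale1r.
by move=> /le_lt_trans; apply; lra.
Qed.
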